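(* Let $X$ be a complex Banach space, let $A$ be a complex function algebra on a regular Hausdorff topological space $\Omega$, and let $A(\Omega,X)\subseteq C_b(\Omega,X)$ be a vector-valued function algebra with base algebra $A$. Suppose that the set $\operatorname{SB}(A)'\cap\operatorname{SB}(A)$ is infinite and let $Y$ be a complex Banach space satisfying one of the following conditions: (a) Every convex combination of non-empty relatively weakly open subsets of $B_Y$ intersects $S_Y$. (b) There exists $y^*\in S_{Y^*}$ such that $\overline{\mathrm{aconv}}\{y\in B_Y: y^*(y)=1\}=B_Y$. Then $A(\Omega,X)\widehat{\otimes}_\pi Y$ has the weak-DD2P.
   Context: $B_Y$, $S_Y$ denote the closed unit ball and unit sphere of $Y$; $\overline{\mathrm{aconv}}$ is the closed absolutely convex hull. A convex combination of sets $V_1,\dots,V_n$ is a set $\sum_{i=1}^n\lambda_iV_i$ with $\lambda_i\geq0$, $\sum_{i=1}^n\lambda_i=1$. $\widehat{\otimes}_\pi$ is the (completed) projective tensor product of Banach spaces. $C_b(\Omega)$ (resp. $C_b(\Omega,X)$) is the space of bounded continuous functions from $\Omega$ to $\mathbb{C}$ (resp. to $X$) with the supremum norm. A function algebra on $\Omega$ is a closed subalgebra of $C_b(\Omega)$ that separates the points of $\Omega$. A vector-valued function algebra $A(\Omega,X)$ is a closed subspace of $C_b(\Omega,X)$ such that: (1) the base algebra $A:=\{x^*\circ f: f\in A(\Omega,X),\ x^*\in X^*\}$ is a function algebra on $\Omega$; (2) for every $f\in A$ and $x\in X$, the function $t\mapsto f(t)x$ belongs to $A(\Omega,X)$; (3)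 for every $f\in A$ and $g\in A(\Omega,X)$, the pointwise product $fg$ belongs to $A(\Omega,X)$. A point $\omega_0\in\Omega$ is a strong boundary point of $A$ if for every open set $U\subseteq\Omega$ containing $\omega_0$ there is $f\in A$ with $f(\omega_0)=1=\|f\|$ and $\sup_{\omega\in\Omega\setminus U}|f(\omega)|<1$; $\operatorname{SB}(A)$ is the set of strong boundary points of $A$, and $\operatorname{SB}(A)'$ is the set of cluster (accumulation) points of $\operatorname{SB}(A)$ in $\Omega$. A Banach space $Z$ has the weak-DD2P if for every non-empty relatively weakly open subset $W$ of $B_Z$ there exists $z\in W$ such that $\sup_{y\in V}\|z-y\|=2$ for every relatively weakly open subset $V$ of $B_Z$ with $z\in V$. *)

(* Defs.v *)
From HB Require Import structures.
From mathcomp Require Import all_boot all_order all_algebra.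
From mathcomp Require Import complex.
From mathcomp Require Import all_classical all_reals all_analysis.

Set Implicit Arguments.
Unset Strict Implicit.
Unset Printing Implicit Defensive.

Import Order.TTheory GRing.Theory Num.Theory.
Import numFieldNormedType.Exports.

Local Open Scope classical_set_scope.
Local Open Scope ring_scope.
Local Open Scope complex_scope.

(* The norm of a complex normed space takes its values in R[i] (they are real
   and nonnegative, see normE); rnorm is the same norm with values in R, where
   suprema and infima are available. *)
Definition rnorm (R : realType) (V : normedModType R[i]) (v : V) : R :=
  complex.Re `|v|.

Section RealNorm.
Variables (R : realType) (V : normedModType R[i]).
Implicit Types u v : V.

Lemma normE v : `|v| = (rnorm v)%:C.
Proof. by rewrite /rnorm RRe_real// ger0_real. Qed.

Lemma rnorm0 : rnorm (0 : V) = 0.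
Proof. by rewrite /rnorm normr0. Qed.

Lemma rnorm_ge0 v : 0 <= rnorm v.
Proof. by rewrite -(@ler0c R) -normE. Qed.

Lemma rnormD u v : rnorm (u + v) <= rnorm u + rnorm v.
Proof. by rewrite -lecR rmorphD/= -!normE ler_normD. Qed.

Lemma rnormZ (a : R[i]) v : rnorm (a *: v) = rnorm (a : R[i]^o) * rnorm v.
Proof.
apply: (@complexI R); rewrite rmorphM/= -!normE normrZ.
by congr (_ * _); rewrite -normE.
Qed.

Lemma rnorm0_eq0 v : rnorm v = 0 -> v = 0.
Proof. by move=> v0; apply/normr0_eq0; rewrite normE v0. Qed.

Lemma bounded_fun_rnorm (T : Type) (f : T -> V) :
  bounded_fun f <-> exists M : R, forall t, rnorm (f t) <= M.
Proof.
split=> [[M [Mreal /(_ (M + 1))]]|[M fM]].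
  rewrite ltrDl ltr01 => /(_ isT) fM.
  exists (complex.Re (M + 1)) => t; rewrite -lecR -normE RRe_real ?fM//.
  by rewrite realD// real1.
exists M%:C; split; first by rewrite complex_real.
by move=> x Mx t _ /=; rewrite normE (le_trans _ (ltW Mx))// lecR.
Qed.

End RealNorm.

Section BoundedContinuous.
Variables (R : realType) (T : topologicalType) (V : normedModType R[i]).

Definition bounded_continuous : {pred T -> V} :=
  mem [set f : T -> V | continuous f /\ bounded_fun f].

Lemma bounded_continuous_submod : submod_closed bounded_continuous.
Proof.
split=> [|a f g].
  rewrite inE; split; first exact: cst_continuous.
  by apply/bounded_fun_rnorm; exists 0 => t; rewrite /rnorm normr0.
rewrite !inE => -[cf /bounded_fun_rnorm[M fM]] [cg /bounded_fun_rnorm[N gN]].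
split.
  by move=> t; apply: cvgD; [apply: cvgZr; exact: cf|exact: cg].
apply/bounded_fun_rnorm; exists (rnorm (a : R[i]^o) * M + N) => t.
by rewrite (le_trans (rnormD _ _))// lerD// rnormZ ler_wpM2l ?rnorm_ge0.
Qed.

HB.instance Definition _ := GRing.isSubmodClosed.Build R[i] (T -> V)
  bounded_continuous bounded_continuous_submod.

(* The space C_b(T, V). *)
Record Cb := MkCb {
  Cb_fun :> T -> V ;
  Cb_funP : Cb_fun \in bounded_continuous
}.

HB.instance Definition _ := [isSub for Cb_fun].
HB.instance Definition _ := [Choice of Cb by <:].
HB.instance Definition _ := [SubChoice_isSubLmodule of Cb by <:].

(* sup set0 is 0, so that the norm is also correct when T is empty. *)
Definition Cb_norm (f : Cb) : R[i] := (sup (range (fun t => rnorm (f t))))%:C.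

Lemma Cb_has_sup (f : Cb) (t : T) : has_sup (range (fun t => rnorm (f t))).
Proof.
split; first by exists (rnorm (f t)), t.
have := Cb_funP f; rewrite inE => -[_ /bounded_fun_rnorm[M fM]].
by exists M => _ [s _ <-].
Qed.

Lemma Cb_norm_ub (f : Cb) t : rnorm (f t) <= sup (range (fun t => rnorm (f t))).
Proof. by apply: ub_le_sup; [case: (Cb_has_sup f t)|exists t]. Qed.

Lemma Cb_norm_lub (f : Cb) (M : R) : 0 <= M ->
  (forall t, rnorm (f t) <= M) -> sup (range (fun t => rnorm (f t))) <= M.
Proof.
move=> M0 fM; have [->|/set0P E0] := eqVneq (range (fun t => rnorm (f t))) set0.
  by rewrite sup0.
by apply: ge_sup => // _ [t _ <-].
Qed.

Lemma Cb_sup_ge0 (f : Cb) : 0 <= sup (range (fun t => rnorm (f t))).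
Proof.
have [->|/set0P[_ [t _ _]]] := eqVneq (range (fun t => rnorm (f t))) set0.
  by rewrite sup0.
exact: le_trans (rnorm_ge0 (f t)) (Cb_norm_ub f t).
Qed.

Lemma Cb_normD (f g : Cb) : Cb_norm (f + g) <= Cb_norm f + Cb_norm g.
Proof.
rewrite /Cb_norm -rmorphD lecR; apply: Cb_norm_lub => [|t].
  by rewrite addr_ge0// Cb_sup_ge0.
by rewrite (le_trans (rnormD _ _))// lerD// Cb_norm_ub.
Qed.

Lemma Cb_normZ (a : R[i]) (f : Cb) : Cb_norm (a *: f) = `|a| * Cb_norm f.
Proof.
have le b (g : Cb) : sup (range (fun t => rnorm ((b *: g) t))) <=
    rnorm (b : R[i]^o) * sup (range (fun t => rnorm (g t))).
  apply: Cb_norm_lub => [|t]; first by rewrite mulr_ge0 ?rnorm_ge0 ?Cb_sup_ge0.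
  by rewrite [X in rnorm X]/= rnormZ ler_wpM2l ?rnorm_ge0 ?Cb_norm_ub.
suff eq_sup : sup (range (fun t => rnorm ((a *: f) t))) =
    rnorm (a : R[i]^o) * sup (range (fun t => rnorm (f t))).
  by rewrite /Cb_norm eq_sup rmorphM [`|a|](normE (a : R[i]^o)).
apply/eqP; rewrite eq_le le andTb.
have [a0|a0] := eqVneq a 0.
  have -> : rnorm (a : R[i]^o) = 0 by rewrite a0; exact: rnorm0.
  by rewrite mul0r Cb_sup_ge0.
have ra : 0 < rnorm (a : R[i]^o) by rewrite -ltcR -normE normr_gt0.
rewrite -ler_pdivlMl// (_ : (rnorm (a : R[i]^o))^-1 = rnorm (a^-1 : R[i]^o)).
  by rewrite (le_trans _ (le _ _))// scalerA mulVf// scale1r.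
apply: (@complexI R); rewrite fmorphV/= -!normE.
by rewrite -normfV.
Qed.

Lemma Cb_norm0_eq0 (f : Cb) : Cb_norm f = 0 -> f = 0.
Proof.
move=> /complexI f0; apply/val_inj/funext => t /=; apply: rnorm0_eq0.
by apply/eqP; rewrite eq_le rnorm_ge0 -f0 Cb_norm_ub.
Qed.

HB.instance Definition _ :=
  Lmodule_isNormed.Build R[i] Cb Cb_normD Cb_normZ Cb_norm0_eq0.

End BoundedContinuous.

Section ClosedSubspace.
Variables (R : realType) (V : normedModType R[i]).

Record closed_subspace := ClosedSubspace {
  subspace_set :> set V ;
  subspace_submod : submod_closed (mem subspace_set) ;
  subspace_closed : closed subspace_set
}.

Variable A : closed_subspace.

Definition subspace_pred : {pred V} := mem (subspace_set A).

HB.instance Definition _ := GRing.isSubmodClosed.Build R[i] V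
  subspace_pred (subspace_submod A).

(* The Banach space A itself, as opposed to the set of its points in V. *)
Record banach_subspace := MkBanachSubspace {
  subspace_val :> V ;
  subspace_valP : subspace_val \in subspace_pred
}.

HB.instance Definition _ := [isSub for subspace_val].
HB.instance Definition _ := [Choice of banach_subspace by <:].
HB.instance Definition _ := [SubChoice_isSubLmodule of banach_subspace by <:].

Definition subspace_norm (x : banach_subspace) : R[i] := `|subspace_val x|.

Lemma subspace_normD (x y : banach_subspace) :
  subspace_norm (x + y) <= subspace_norm x + subspace_norm y.
Proof. exact: ler_normD. Qed.

Lemma subspace_normZ (a : R[i]) (x : banach_subspace) :
  subspace_norm (a *: x) = `|a| * subspace_norm x.
Proof. exact: normrZ. Qed.

Lemma subspace_norm0_eq0 (x : banach_subspace) : subspace_norm x = 0 -> x = 0.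
Proof. by move=> /normr0_eq0 x0; apply: val_inj. Qed.

HB.instance Definition _ := Lmodule_isNormed.Build R[i] banach_subspace
  subspace_normD subspace_normZ subspace_norm0_eq0.

End ClosedSubspace.

Section BanachSpaceNotions.
Variables (R : realType) (V : normedModType R[i]).

Definition unit_ball : set V := [set x | `|x| <= 1].

Definition unit_sphere : set V := [set x | `|x| = 1].

Record topdual := TopDual {
  topdual_fun :> {linear V -> R[i]^o} ;
  topdual_continuous : continuous topdual_fun
}.

Definition dual_norm (f : topdual) : R := sup [set rnorm (f x) | x in unit_ball].

Definition weak_space : topologicalType :=
  sup_topology (fun f : topdual => Topological.on (initial_topology (f : V -> _))).

Definition relatively_weakly_open (W : set V) :=
  exists2 U : set weak_space, open U & W = unit_ball `&` U.

Definition aconv (S : set V) : set V :=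
  [set x | exists n (l : 'I_n -> R[i]) (a : 'I_n -> V),
    [/\ \sum_(i < n) `|l i| <= 1, forall i, S (a i) &
        x = \sum_(i < n) l i *: a i]].

(* The convex combination of the sets W i with coefficients l i. *)
Definition combination n (l : 'I_n -> R[i]) (W : 'I_n -> set V) : set V :=
  [set x | exists2 v : 'I_n -> V, forall i, W i (v i) &
    x = \sum_(i < n) l i *: v i].

(* The diameter 2 condition is meaningful as a real supremum: unit_ball is
   bounded and W' contains z. *)
Definition weak_DD2P :=
  forall W : set V, relatively_weakly_open W -> W !=set0 ->
  exists2 z, W z &
    forall W' : set V, relatively_weakly_open W' -> W' z ->
    sup [set rnorm (z - y) | y in W'] = 2.

Definition weakly_open_combinations_meet_sphere :=
  forall n (l : 'I_n -> R[i]) (W : 'I_n -> set V),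
    (forall i, 0 <= l i) -> \sum_(i < n) l i = 1 ->
    (forall i, relatively_weakly_open (W i) /\ W i !=set0) ->
  combination l W `&` unit_sphere !=set0.

Definition ball_aconv_of_face :=
  exists2 f : topdual, dual_norm f = 1 &
    closure (aconv [set y | unit_ball y /\ f y = 1]) = unit_ball.

End BanachSpaceNotions.

Section ProjectiveTensorProduct.
Variables (R : realType) (E F : normedModType R[i]).

(* A tensor of the algebraic tensor product of E and F is represented by a
   formal sum of elementary tensors, i.e., by a sequence of pairs; two formal
   sums are the same tensor when every bilinear form takes the same value on
   them, tensors being functionals on the space of bilinear forms. *)
Definition tensor_eval (W : lmodType R[i]) (b : E -> F -> W)
  (s : seq (E * F)) : W := \sum_(p <- s) b p.1 p.2.

Definition tensor_eq (s s' : seq (E * F)) :=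
  forall b : {bilinear E -> F -> R[i]^o}, tensor_eval b s = tensor_eval b s'.

Definition projective_norm (s : seq (E * F)) : R :=
  inf [set \sum_(p <- s') rnorm p.1 * rnorm p.2 | s' in tensor_eq s].

(* The Banach space Z, with the bilinear map t, is the completion of the
   algebraic tensor product for the projective norm: t induces a linear
   isometry from the latter onto a dense subspace of Z. *)
Definition is_projective_tensor_product (Z : completeNormedModType R[i])
    (t : {bilinear E -> F -> Z}) :=
  (forall s, rnorm (tensor_eval t s) = projective_norm s) /\
  closure (range (tensor_eval t)) = setT.

End ProjectiveTensorProduct.

Section FunctionAlgebra.
Variables (R : realType) (T : topologicalType).
Local Notation C := (R[i]^o : normedModType R[i]).

Definition function_algebra (A : set (Cb T C)) :=
  [/\ submod_closed (mem A), closed A,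
      forall f g, A f -> A g -> (@Cb_fun R T C @` A) (fun t => f t * g t) &
      forall s t, s <> t -> exists2 f, A f & f s <> f t].

Definition strong_boundary (A : set (Cb T C)) : set T :=
  [set w | forall U : set T, open U -> U w ->
    exists f, [/\ A f, f w = 1, `|f| = 1 &
      sup [set rnorm (f v) | v in ~` U] < 1]].

Variable X : normedModType R[i].

Definition base_algebra (B : set (Cb T X)) : set (Cb T C) :=
  [set g : Cb T C | exists2 f, B f & exists x' : topdual X, forall t, g t = x' (f t)].

Definition vector_function_algebra (B : closed_subspace (Cb T X)) :=
  [/\ function_algebra (base_algebra B),
      forall f x, base_algebra B f -> (@Cb_fun R T X @` B) (fun t => f t *: x) &
      forall f g, base_algebra B f -> subspace_set B g ->
        (@Cb_fun R T X @` B) (fun t => f t *: g t)].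

End FunctionAlgebra.

(* Main.v *)
Require Import Defs.
From HB Require Import structures.
From mathcomp Require Import all_boot all_order all_algebra.
From mathcomp Require Import complex.
From mathcomp Require Import all_classical all_reals all_analysis.
From mathcomp Require Import ring lra.

Set Implicit Arguments.
Unset Strict Implicit.
Unset Printing Implicit Defensive.

Import Order.TTheory GRing.Theory Num.Theory.
Import numFieldNormedType.Exports.

Local Open Scope classical_set_scope.
Local Open Scope ring_scope.
Local Open Scope complex_scope.

(** Write [E] for the Banach space [A(Omega, X)]. The plan is to find, in a given
    weakly open [W], a convex combination [z] of tensors [f i (x) y i] such that
    all the [f i] take one and the same value [x] of norm one at a point [w], and
    such that a functional [l] of norm one on [Y] takes the value [1] at the
    combination of the [y i]. The point [w] is both a strong boundary point and
    a limit of strong boundary points. Near [w] the [f i] are almost equal to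
    [x], so that at a strong boundary point [s] near [w] they can be changed into
    functions with value [- x] at [s], the [y i] being kept. If [k] is a norming
    functional of [x], the bilinear form [(f, y) |-> k (f s) * l y] has norm one
    and separates [z] from the new combination [v] by almost [2]. It remains to
    see that [v] can be taken in a given weak neighbourhood of [z], and likewise
    that the first change, which creates the common value at [w], does not leave
    [W].

    Both changes come from [prescribe_value_nearby]. If [phi] is a peak function
    at [w], then [(1 - d) (1 - phi) f + phi x] has the value [x] at [w] and is
    close to [f] away from [w]. It stays in the unit ball as soon as
    [|phi| + (1 - d) |1 - phi| <= 1]; peak functions of this kind are built in
    [stolz_peak] from the definition of a strong boundary point. Now do this at
    [N] points with disjoint neighbourhoods. The changes have almost disjoint
    supports, hence the sum of their moduli is bounded independently of [N], and
    so is the sum of the values of a continuous functional at them. For [N] large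
    one of the changes is therefore small for finitely many given functionals.
    An infinite supply of points is needed twice: the infinite set of limit
    points that are strong boundary points provides [w], and the strong boundary
    points near [w], infinite in number because [w] is a limit point, provide
    [s].

    The functional [l] comes from the hypothesis on [Y]. By [unit_ball_approx],
    [W] contains a convex combination of tensors of vectors of the unit balls.
    Under the first hypothesis the [y i] can be moved within weakly open sets
    until their combination has norm one, and a norming functional of the
    combination is taken for [l]. Under the second one, each [y i] is
    approximated by absolutely convex combinations of points of the face, and the
    scalars are moved to the other factor of the tensor. *)

(** * The real-valued norm of a complex normed space *)

Section RealValuedNorm.
Variables (R : realType) (V : normedModType R[i]).
Implicit Types (u v : V) (z w : R[i]).

Lemma rnormN v : rnorm (- v) = rnorm v.
Proof. by rewrite /rnorm normrN. Qed.

Lemma rnormBC u v : rnorm (u - v) = rnorm (v - u).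
Proof. by rewrite -rnormN opprB. Qed.

Lemma rnormB u v : rnorm (u - v) <= rnorm u + rnorm v.
Proof. by rewrite (le_trans (rnormD _ _))// rnormN. Qed.

Lemma rnorm_sum (I : Type) (r : seq I) (P : pred I) (F : I -> V) :
  rnorm (\sum_(i <- r | P i) F i) <= \sum_(i <- r | P i) rnorm (F i).
Proof.
elim/big_rec2: _ => [|i y x _ xy]; first by rewrite rnorm0.
by rewrite (le_trans (rnormD _ _))// lerD2l.
Qed.

Lemma rnorm_real (r : R) : rnorm (r%:C : R[i]^o) = `|r|.
Proof. by rewrite /rnorm normc_def/= expr0n/= addr0 sqrtr_sqr. Qed.

Lemma rnorm_nneg (r : R) : 0 <= r -> rnorm (r%:C : R[i]^o) = r.
Proof. by move=> r0; rewrite rnorm_real ger0_norm. Qed.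

Lemma scale_realM (r s : R) v : (r * s)%:C *: v = r%:C *: (s%:C *: v).
Proof. by rewrite rmorphM scalerA. Qed.

Lemma rnorm1 : rnorm (1 : R[i]^o) = 1.
Proof. by rewrite rnorm_nneg. Qed.

Lemma rnormM z w :
  rnorm (z * w : R[i]^o) = rnorm (z : R[i]^o) * rnorm (w : R[i]^o).
Proof. exact: (rnormZ (V := R[i]^o) z w). Qed.

Lemma unit_ballE v : unit_ball v = (rnorm v <= 1) :> Prop.
Proof. by rewrite /unit_ball/= normE -[1]/(1%:C) lecR. Qed.

Lemma unit_sphereE v : unit_sphere v = (rnorm v = 1) :> Prop.
Proof.
rewrite /unit_sphere/= normE; apply/propext; split=> [/complexI//|->//].
Qed.

(** Rotating a vector by [c] makes the value [z] of a linear functional at it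
    nonnegative, without increasing the norm of the vector. *)
Lemma complex_sign z : exists2 c : R[i],
  rnorm (c : R[i]^o) <= 1 & c * z = (rnorm (z : R[i]^o))%:C.
Proof.
have [->|z0] := eqVneq z 0.
  by exists 0; rewrite ?mul0r ?rnorm0.
exists (`|z| / z); last by rewrite divfK// (normE (z : R[i]^o)).
suff -> : rnorm (`|z| / z : R[i]^o) = 1 by [].
by apply: complexI; rewrite -normE normrM normfV normr_id divff// normr_eq0.
Qed.

Lemma rnorm_le_ReIm z :
  rnorm (z : R[i]^o) <= `|complex.Re z| + `|complex.Im z|.
Proof.
rewrite {1}(complexE z) (le_trans (rnormD (V := R[i]^o) _ _))//.
rewrite rnormM !rnorm_real lerD2l.
by rewrite /rnorm normc_def/= expr0n/= add0r expr1n sqrtr1 mul1r.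
Qed.

End RealValuedNorm.

Section RealNormTopology.
Variables (R : realType).

Lemma nbhs_rnormP (V : normedModType R[i]) (v : V) (A : set V) :
  nbhs v A <-> exists2 e : R, 0 < e & forall u, rnorm (v - u) < e -> A u.
Proof.
split=> [/nbhs_ballP[e /= e0 eA]|[e e0 eA]].
  have ee : e = (complex.Re e)%:C by rewrite RRe_real// gtr0_real.
  exists (complex.Re e); first by rewrite -ltcR -ee.
  by move=> u ue; apply: eA; rewrite -ball_normE /= normE ee ltcR.
apply/nbhs_ballP; exists e%:C; first by rewrite /= ltcR.
by move=> u; rewrite -ball_normE /= normE ltcR => /eA.
Qed.

Lemma continuous_rnormP (T : topologicalType) (V : normedModType R[i])
    (f : T -> V) : continuous f <->
  forall t (e : R), 0 < e -> \forall s \near t, rnorm (f t - f s) < e.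
Proof.
split=> [cf t e e0|H t A /nbhs_rnormP[e e0 eA]].
  have /cf : nbhs (f t) [set u | rnorm (f t - u) < e].
    by apply/nbhs_rnormP; exists e.
  exact.
by apply: filterS (H t e e0) => s /eA.
Qed.

Lemma continuous_rnorm (T : topologicalType) (V : normedModType R[i])
    (f : T -> V) : continuous f -> continuous (fun t => rnorm (f t) : R^o).
Proof.
move=> /continuous_rnormP cf t; apply/cvgrPdist_lt => e e0.
apply: filterS (cf t e e0) => s; apply: le_lt_trans.
have := rnormD (f t - f s) (f s); have := rnormD (f s - f t) (f t).
by rewrite !subrK (rnormBC (f s)) ler_norml; lra.
Qed.

Lemma open_sum_rnorm_lt (T : topologicalType) (V : normedModType R[i])
    (I : Type) (r : seq I) (f : I -> T -> V) (e : R) :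
  (forall i, continuous (f i)) ->
  open [set t | \sum_(i <- r) rnorm (f i t) < e].
Proof.
move=> cf; suff : continuous (fun t => \sum_(i <- r) rnorm (f i t) : R^o).
  by move=> /continuousP/(_ _ (open_lt (y := e))).
elim: r => [|i r IH].
  rewrite (_ : (fun t => _) = cst 0); first exact: cst_continuous.
  by apply/funext => t; rewrite big_nil.
rewrite (_ : (fun t => _) = (fun t => rnorm (f i t) : R^o) \+
    (fun t => \sum_(i <- r) rnorm (f i t))); last first.
  by apply/funext => t; rewrite big_cons.
by move=> t; apply: cvgD; [exact: continuous_rnorm|exact: IH].
Qed.

Lemma open_rnorm_lt (T : topologicalType) (V : normedModType R[i])
    (f : T -> V) (e : R) : continuous f -> open [set t | rnorm (f t) < e].
Proof.
by move=> /continuous_rnorm/continuousP/(_ _ (open_lt (y := e))).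
Qed.

Lemma rnorm_bounded_continuous (V W : normedModType R[i])
    (l : {linear V -> W}) (M : R) :
  (forall v, rnorm (l v) <= M * rnorm v) -> continuous l.
Proof.
move=> lM; apply/continuous_rnormP => v e e0; apply/nbhs_rnormP.
have M1 : 0 < `|M| + 1 by rewrite ltr_pwDr.
exists (e / (`|M| + 1)); first exact: divr_gt0.
move=> u; rewrite ltr_pdivlMr// -linearB => h; apply: le_lt_trans (lM _) _.
apply: le_lt_trans h; rewrite mulrDr mulr1 [in leRHS]mulrC.
rewrite -[leLHS]addr0 lerD ?rnorm_ge0// ler_wpM2r ?rnorm_ge0// ler_norm//.
Qed.

Lemma topdual_bounded (V : normedModType R[i]) (l : topdual V) :
  exists2 M : R, 0 <= M & forall v, rnorm (l v : R[i]^o) <= M * rnorm v.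
Proof.
have /continuous_rnormP/(_ 0 1 ltr01)/nbhs_rnormP[e e0 eM] :=
  @topdual_continuous _ _ l.
exists (2 / e) => [|v]; first by rewrite divr_ge0// ltW.
have [->|v0] := eqVneq v 0; first by rewrite linear0 !rnorm0 mulr0.
have nv : 0 < rnorm v.
  rewrite lt_neqAle rnorm_ge0 andbT; apply: contra_neq v0 => /esym.
  exact: rnorm0_eq0.
pose a := e / (2 * rnorm v).
have a0 : 0 < a by rewrite divr_gt0// mulr_gt0.
have small : rnorm (0 - a%:C *: v) < e.
  rewrite sub0r rnormN rnormZ rnorm_nneg ?ltW// /a mulrAC.
  rewrite -mulf_div divff ?gt_eqF// mulr1.
  by rewrite ltr_pdivrMr// ltr_pMr// ltr1n.
have := eM _ small; rewrite linear0 linearZ/= sub0r rnormN.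
rewrite [X in X < _]rnormZ rnorm_nneg ?(ltW a0)// => h.
rewrite -(ler_pM2l a0) (le_trans (ltW h))//.
have -> // : a * (2 / e * rnorm v) = 1.
by rewrite /a; field; rewrite !gt_eqF.
Qed.

Lemma exprn_small (q e : R) : 0 <= q < 1 -> 0 < e ->
  exists n : nat, q ^+ n < e.
Proof.
move=> /andP[q0 q1] e0; have q1' : `|q| < 1 by rewrite ger0_norm.
have /cvgrPdist_lt/(_ e e0)[n _ /(_ n (leqnn n))/=] := cvg_expr q1'.
by rewrite sub0r normrN ger0_norm ?exprn_ge0//; exists n.
Qed.

(** With geometric increments, [a n - q ^+ n] increases and [a n + q ^+ n]
    decreases, and any point between the two sequences is a limit. *)
Lemma geometric_limit (q : R) (a : nat -> R) : 0 <= q ->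
  (forall n, `|a n.+1 - a n| <= (1 - q) * q ^+ n) ->
  exists l, forall n, `|l - a n| <= q ^+ n.
Proof.
move=> q0 ha; pose lo n := a n - q ^+ n; pose hi n := a n + q ^+ n.
have step n : lo n <= lo n.+1 /\ hi n.+1 <= hi n.
  by have := ha n; rewrite /lo /hi exprS ler_norml mulrBl mul1r; lra.
have lo_homo : {homo lo : m n / (m <= n)%N >-> m <= n}.
  by apply: homo_leq => [//|y x z|n]; [exact: le_trans|case: (step n)].
have hi_homo : {homo hi : m n / (m <= n)%N >-> n <= m}.
  by apply: homo_leq => [//|y x z xy yz|n]; [exact: le_trans yz xy|case: (step n)].
have lohi m n : lo m <= hi n.
  rewrite (le_trans (lo_homo _ _ (leq_maxl m n)))//.
  rewrite (le_trans _ (hi_homo _ _ (leq_maxr m n)))//.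
  by rewrite /lo /hi; have := exprn_ge0 (maxn m n) q0; lra.
exists (sup (range lo)) => n.
have lower : lo n <= sup (range lo).
  by apply: ub_le_sup; [exists (hi 0) => _ [m _ <-]|exists n].
have upper : sup (range lo) <= hi n.
  by apply: ge_sup => [|_ [m _ <-]//]; exists (lo 0); exists 0%N.
by rewrite /lo /hi in lower upper; rewrite ler_norml; lra.
Qed.

Lemma geometric_limit_complex (q : R) (a : nat -> R[i]) : 0 <= q ->
  (forall n, rnorm (a n.+1 - a n : R[i]^o) <= (1 - q) * q ^+ n) ->
  exists l, forall n, rnorm (l - a n : R[i]^o) <= 2 * q ^+ n.
Proof.
move=> q0 ha.
have [x hx] : exists x, forall n, `|x - complex.Re (a n)| <= q ^+ n.
  apply: geometric_limit => // n; apply: le_trans (ha n).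
  by rewrite -raddfB -lecR -normE normc_ge_Re.
have [y hy] : exists y, forall n, `|y - complex.Im (a n)| <= q ^+ n.
  apply: geometric_limit => // n; apply: le_trans (ha n).
  rewrite -raddfB -lecR -normE/=; have := normc_ge_Re (a n.+1 - a n).
  rewrite normc_def => _; rewrite lecR -sqrtr_sqr.
  by rewrite ler_wsqrtr// lerDr sqr_ge0.
exists (x +i* y) => n; rewrite (le_trans (rnorm_le_ReIm _))//.
rewrite mulr_natl mulr2n; case: (a n) (hx n) (hy n) => u v /= hu hv.
exact: lerD.
Qed.

End RealNormTopology.

(** * Norming functionals *)

Section NormingFunctional.
Variables (R : realType) (V : normedModType R[i]).
Implicit Types (p : V -> R) (u v w : V).

Definition sublinear p := (forall u v, p (u + v) <= p u + p v) /\
  (forall (r : R) v, 0 <= r -> p (r%:C *: v) <= r * p v).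

Lemma sublinear_homog p (r : R) v : sublinear p -> 0 <= r ->
  p (r%:C *: v) = r * p v.
Proof.
(* for [0 < r], the inequality for [r^-1] at [r v] is the missing one *)
move=> [subadd subhom]; rewrite le_eqVlt => /orP[/eqP<-|r0].
  rewrite scale0r mul0r; apply/eqP; rewrite eq_le.
  have := subhom 0 v (lexx 0); rewrite scale0r mul0r => ->/=.
  by have := subadd 0 0; rewrite addr0; lra.
apply/eqP; rewrite eq_le (subhom _ _ (ltW r0))/= -ler_pdivlMl//.
have := subhom r^-1 (r%:C *: v); rewrite invr_ge0 ltW// => /(_ isT).
by rewrite scalerA -rmorphM/= mulVf ?gt_eqF// scale1r.
Qed.

Lemma sublinear0 p : sublinear p -> p 0 = 0.
Proof.
by move=> sp; have := sublinear_homog 0 sp (lexx 0); rewrite scale0r mul0r.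
Qed.

Lemma sublinear_opp_ge p v : sublinear p -> - p (- v) <= p v.
Proof.
move=> sp; have := sp.1 v (- v); rewrite subrr sublinear0//; lra.
Qed.

(** The functional is the infimum of [p (w + t v) - t p v] over [t >= 0]: every
    sublinear [m] below [p] with [m (- v) <= - p v] satisfies
    [m w <= m (w + t v) + t m (- v)], and hence lies below this infimum. *)
Lemma sublinear_shear p v : sublinear p ->
  exists p', [/\ sublinear p', forall w, p' w <= p w & p' (- v) <= - p v].
Proof.
move=> sp.
pose S w := [set p (w + t%:C *: v) - t * p v | t in [set t | 0 <= t]].
pose p' w := inf (S w).
have lb w t : 0 <= t -> - p (- w) <= p (w + t%:C *: v) - t * p v.
  move=> t0; have := sp.1 (- w) (w + t%:C *: v).
  by rewrite addrA addNr add0r sublinear_homog//; lra.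
have p'le w t : 0 <= t -> p' w <= p (w + t%:C *: v) - t * p v.
  move=> t0; apply: ge_inf; last by exists t.
  by exists (- p (- w)) => _ [s s0 <-]; exact: lb.
have p'ge w m : (forall t, 0 <= t -> m <= p (w + t%:C *: v) - t * p v) ->
    m <= p' w.
  move=> hm; apply: lb_le_inf; last by move=> _ [t t0 <-]; exact: hm.
  by exists (p (w + 0%:C *: v) - 0 * p v); exists 0 => //=.
exists p'; split.
- split=> [u w|r w].
  + suff : p' (u + w) - p' u <= p' w by lra.
    apply: (p'ge) => t t0.
    suff : p' (u + w) - (p (w + t%:C *: v) - t * p v) <= p' u by lra.
    apply: (p'ge) => s s0; have := p'le (u + w) (s + t) (addr_ge0 s0 t0).
    rewrite rmorphD/= scalerDl addrACA mulrDl.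
    by have := sp.1 (u + s%:C *: v) (w + t%:C *: v); lra.
  + rewrite le_eqVlt => /orP[/eqP<-|r0].
      rewrite scale0r mul0r; have := p'le 0 0 (lexx 0).
      by rewrite scale0r addr0 mul0r subr0 (sublinear0 sp).
    rewrite -ler_pdivrMl//; apply: (p'ge) => t t0; rewrite ler_pdivrMl//.
    have := p'le (r%:C *: w) (r * t) (mulr_ge0 (ltW r0) t0).
    rewrite rmorphM/= -scalerA -scalerDr (sublinear_homog _ sp (ltW r0)).
    by rewrite mulrBr mulrA.
- by move=> w; have := p'le w 0 (lexx 0); rewrite scale0r addr0 mul0r subr0.
- have := p'le (- v) 1 ler01.
  by rewrite scale1r addNr (sublinear0 sp) mul1r sub0r.
Qed.

(** By Zorn's lemma, since the pointwise infimum of a chain of sublinear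
    functionals is sublinear. *)
Lemma minimal_sublinear p0 : sublinear p0 ->
  exists p, [/\ sublinear p, forall v, p v <= p0 v &
    forall p', sublinear p' -> (forall v, p' v <= p v) -> p' = p].
Proof.
move=> s0; pose T := {p | sublinear p /\ forall v, p v <= p0 v}.
pose below (p q : T) := `[< forall v, sval q v <= sval p v >].
have [||||[p [sp pp0]] pmin] := @Zorn T below.
- by move=> p; apply/asboolP.
- move=> p q r /asboolP qp /asboolP rq; apply/asboolP => v.
  exact: le_trans (rq v) (qp v).
- move=> [p ?] [q ?] /asboolP/= qp /asboolP/= pq; apply: eq_exist.
  by apply/funext => v; apply/eqP; rewrite eq_le qp pq.
- move=> A Atot.
  have [[pa Apa]|A0] := pselect (A !=set0); last first.
    exists (exist _ p0 (conj s0 (fun v => lexx (p0 v)))) => q Aq.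
    by case: A0; exists q.
  pose m v := inf [set sval q v | q in A].
  have mle q v : A q -> m v <= sval q v.
    move=> Aq; apply: ge_inf; last by exists q.
    exists (- p0 (- v)) => _ [[r [sr rp0]] Ar <-] /=.
    by have := sublinear_opp_ge v sr; have := rp0 (- v); lra.
  have mge v c : (forall q, A q -> c <= sval q v) -> c <= m v.
    move=> hc; apply: lb_le_inf; first by exists (sval pa v), pa.
    by move=> _ [q Aq <-]; exact: hc.
  have sm : sublinear m.
    split=> [u v|r v r0].
      suff : m (u + v) - m u <= m v by lra.
      apply: (mge) => q Aq.
      suff : m (u + v) - sval q v <= m u by lra.
      apply: (mge) => r Ar.
      (* on a chain, one of the two functionals is below the other *)
      have [/asboolP rq|/asboolP qr] := Atot _ _ Aq Ar.
        have := mle r (u + v) Ar; have := (svalP r).1.1 u v.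
        by have := rq v; lra.
      have := mle q (u + v) Aq; have := (svalP q).1.1 u v.
      by have := qr u; lra.
    move: r0; rewrite le_eqVlt => /orP[/eqP<-|r0].
      have := mle pa 0 Apa; rewrite (sublinear0 (svalP pa).1).
      by rewrite scale0r mul0r.
    rewrite -ler_pdivrMl//; apply: (mge) => q Aq; rewrite ler_pdivrMl//.
    rewrite -(sublinear_homog _ (svalP q).1 (ltW r0)); exact: mle.
  have mp0 v : m v <= p0 v.
    by rewrite (le_trans (mle pa v Apa))//; case: (svalP pa).
  by exists (exist _ m (conj sm mp0)) => q Aq; apply/asboolP => v; exact: mle.
exists p; split=> // p' sp' p'p.
have p'p0 v : p' v <= p0 v by exact: le_trans (p'p v) (pp0 v).
by have /(congr1 sval) := pmin (exist _ p' (conj sp' p'p0)) (asboolT p'p).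
Qed.

(** A minimal sublinear functional is odd, because it cannot be pushed down
    along any vector, and an odd sublinear functional is linear. *)
Lemma real_norming_functional v0 : exists g : V -> R,
  [/\ forall u v, g (u + v) = g u + g v,
      forall (r : R) v, g (r%:C *: v) = r * g v,
      forall v, g v <= rnorm v & g v0 = rnorm v0].
Proof.
have snorm : sublinear (@rnorm R V).
  by split=> [|r v r0]; [exact: rnormD|rewrite rnormZ rnorm_nneg].
have [p0 [s0 p0n p0v]] := sublinear_shear v0 snorm.
have [g [sg gp0 gmin]] := minimal_sublinear s0.
have godd v : g (- v) = - g v.
  apply/eqP; rewrite eq_le; apply/andP; split; last first.
    by have := sublinear_opp_ge v sg; lra.
  by have [p' [sp' p'g]] := sublinear_shear v sg; rewrite (gmin p').
exists g; split.
- move=> u v; apply/eqP; rewrite eq_le sg.1/=.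
  by have := sg.1 (- u) (- v); rewrite -opprD !godd; lra.
- move=> r v; have [r0|r0] := leP 0 r; first exact: sublinear_homog.
  rewrite -[r]opprK rmorphN scaleNr godd sublinear_homog ?oppr_ge0 ?ltW//.
  by rewrite !mulNr.
- by move=> v; exact: le_trans (gp0 v) (p0n v).
- apply/eqP; rewrite eq_le (le_trans (gp0 v0))//=.
  by have := gp0 (- v0); rewrite godd; lra.
Qed.

(** A real-linear [g] is the real part of the complex-linear functional
    [g v - i g (i v)], which has the same norm, because the modulus of its value
    at [v] is its value, hence the value of [g], at some rotation of [v]. *)
Lemma norming_functional v0 : exists l : topdual V,
  (forall v, rnorm (l v : R[i]^o) <= rnorm v) /\ l v0 = (rnorm v0)%:C.
Proof.
have [g [gD gZ gle gv0]] := real_norming_functional v0.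
pose f v : R[i]^o := g v -i* g ('i%C *: v).
have fD : {morph f : u v / u + v}.
  by move=> u v; rewrite /f scalerDr !gD opprD.
have gN v : g (- v) = - g v.
  by have := gZ (- 1) v; rewrite rmorphN rmorph1 scaleN1r mulN1r.
have fr (r : R) v : f (r%:C *: v) = r%:C * f v.
  by rewrite /f scalerA mulrC -scalerA !gZ; simpc.
have fi v : f ('i%C *: v) = 'i%C * f v.
  by rewrite /f scalerA -expr2 sqr_i scaleN1r gN; simpc.
have fZ (a : R[i]) v : f (a *: v) = a *: f v.
  rewrite [a]complexE scalerDl fD -scalerA fi !fr mulrA.
  by rewrite /GRing.scale/= mulrDl.
pose flin := GRing.isLinear.Build R[i] V R[i]^o _ f
  (fun a u v => etrans (fD _ _) (congr1 (fun z => z + f v) (fZ a u))).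
pose F : {linear V -> R[i]^o} := HB.pack f flin.
have Fle v : rnorm (f v) <= rnorm v.
  have [c c1 cfv] := complex_sign (f v).
  have : complex.Re (f (c *: v)) <= rnorm (c *: v) by exact: gle.
  rewrite fZ [X in complex.Re X]cfv/= rnormZ => /le_trans; apply.
  by rewrite ler_piMl// rnorm_ge0.
have cF : continuous F.
  by apply: (@rnorm_bounded_continuous _ _ _ F 1) => v; rewrite mul1r; exact: Fle.
exists (TopDual cF); split=> //; change (f v0 = (rnorm v0)%:C).
(* the imaginary part vanishes at [v0], for the real part is the whole norm *)
have := Fle v0; rewrite /f -gv0; set b := g ('i%C *: v0) => le_ab.
suff -> : b = 0 by rewrite oppr0.
have gv0_ge0 : 0 <= g v0 by rewrite gv0 rnorm_ge0.
move: le_ab; rewrite -(ler_pXn2r (n := 2)) ?nnegrE ?rnorm_ge0//.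
rewrite /rnorm normc_def/= sqr_sqrtr ?addr_ge0 ?sqr_ge0// sqrrN.
rewrite gerDl => b2; apply/eqP; rewrite -sqrf_eq0 eq_le b2.
exact: sqr_ge0.
Qed.

End NormingFunctional.

(** * Neighbourhoods in the weak topology *)

Section WeakTopology.
Variables (R : realType) (V : normedModType R[i]).
Implicit Types (ls : seq (topdual V)) (v z : V).

Definition weak_seminorm ls v : R := \sum_(l <- ls) rnorm (l v : R[i]^o).

Lemma weak_seminorm0 ls : weak_seminorm ls 0 = 0.
Proof. by rewrite /weak_seminorm big1// => l _; rewrite linear0 rnorm0. Qed.

Lemma weak_seminormD ls u v :
  weak_seminorm ls (u + v) <= weak_seminorm ls u + weak_seminorm ls v.
Proof.
rewrite /weak_seminorm -big_split/=; apply: ler_sum => l _.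
by rewrite linearD rnormD.
Qed.

Lemma weak_seminormZ ls (a : R[i]) v :
  weak_seminorm ls (a *: v) = rnorm (a : R[i]^o) * weak_seminorm ls v.
Proof.
rewrite /weak_seminorm mulr_sumr; apply: eq_bigr => l _.
by rewrite linearZ rnormZ.
Qed.

Lemma weak_seminorm_sum ls (I : Type) (r : seq I) (F : I -> V) :
  weak_seminorm ls (\sum_(i <- r) F i) <= \sum_(i <- r) weak_seminorm ls (F i).
Proof.
elim/big_rec2: _ => [|i y x _ xy]; first by rewrite weak_seminorm0.
by rewrite (le_trans (weak_seminormD _ _ _))// lerD2l.
Qed.

Lemma weak_seminorm_bounded ls : exists2 M : R, 0 <= M &
  forall v, weak_seminorm ls v <= M * rnorm v.
Proof.
elim: ls => [|l ls [M M0 HM]].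
  by exists 0 => // v; rewrite /weak_seminorm big_nil mul0r.
have [N N0 HN] := topdual_bounded l.
exists (N + M) => [|v]; first exact: addr_ge0.
rewrite /weak_seminorm big_cons mulrDl. exact: lerD (HN v) (HM v).
Qed.

Lemma topdual_weakly_continuous (l : topdual V) :
  continuous (l : weak_space V -> R[i]^o).
Proof.
move=> v; have fv : Filter (nbhs (v : weak_space V)) := nbhs_filter _.
have [+ _] := @cvg_sup V (topdual V) (fun f : topdual V =>
  Topological.on (initial_topology (f : V -> _))) (nbhs (v : weak_space V)) v fv.
move=> /(_ (fun A => id)) /(_ l) nv.
have := @initial_continuous V R[i]^o (l : V -> _) v.
by apply: cvg_trans => A; exact: nv.
Qed.

Lemma weak_ball_open ls z (e : R) :
  open ([set v | weak_seminorm ls (v - z) < e] : set (weak_space V)).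
Proof.
apply: (@open_sum_rnorm_lt R (weak_space V) R[i]^o _ ls
  (fun l v => l (v - z)) e) => l.
rewrite (_ : (fun v => l (v - z)) = (fun v => l v - l z)); last first.
  by apply/funext => v; rewrite linearB.
apply/continuous_rnormP => v e' e'0.
have /continuous_rnormP/(_ v e' e'0) := topdual_weakly_continuous (l := l).
by apply: filterS => w; rewrite opprB addrA subrK.
Qed.

(** The weak seminorm balls around [z] generate a filter, which converges to
    [z] for the initial topology of each functional, hence for their
    supremum. *)
Lemma weak_open_seminorm (U : set (weak_space V)) z : open U -> U z ->
  exists ls, exists2 e : R, 0 < e &
    forall v, weak_seminorm ls (v - z) < e -> U v.
Proof.
move=> oU Uz.
pose F : set_system V := [set A : set V | exists ls, exists2 e : R, 0 < e &
  forall v, weak_seminorm ls (v - z) < e -> A v].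
have fF : Filter F.
  split.
  - by exists [::]; exists 1.
  - move=> A B [ls [e e0 eA]] [ls' [e' e'0 eB]].
    exists (ls ++ ls'); exists (Num.min e e'); first by rewrite lt_min e0.
    move=> v; rewrite /weak_seminorm big_cat/= -/(weak_seminorm _ _).
    rewrite -/(weak_seminorm _ _) lt_min => /andP[h h'].
    have pos ks : 0 <= weak_seminorm ks (v - z).
      by apply: sumr_ge0 => l _; exact: rnorm_ge0.
    by split; [apply: eA|apply: eB]; have := pos ls; have := pos ls'; lra.
  - by move=> A B AB [ls [e e0 eA]]; exists ls; exists e => // v /eA; exact: AB.
have /(_ _)/(_ U) := proj2 (@cvg_sup V (topdual V) (fun f : topdual V =>
  Topological.on (initial_topology (f : V -> _))) F z fF).
apply; last by apply: open_nbhs_nbhs; split.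
move=> l A; rewrite nbhsE => -[B [[C oC <-] Cz] CA].
have /nbhs_rnormP[e e0 eC] : nbhs (l z : R[i]^o) C by apply: open_nbhs_nbhs.
exists [:: l]; exists e => // v.
rewrite /weak_seminorm big_seq1 linearB rnormBC => h.
by apply: CA; exact: eC.
Qed.

Lemma weak_open_norm (U : set (weak_space V)) z : open U -> U z ->
  exists2 e : R, 0 < e & forall v, rnorm (v - z) < e -> U v.
Proof.
move=> oU Uz; have [ls [e e0 eU]] := weak_open_seminorm oU Uz.
have [M M0 HM] := weak_seminorm_bounded ls.
have M1 : 0 < M + 1 by rewrite ltr_pwDr.
exists (e / (M + 1)) => [|v]; first exact: divr_gt0.
rewrite ltr_pdivlMr// => h; apply: eU; apply: le_lt_trans (HM _) _.
by apply: le_lt_trans h; rewrite mulrDr mulr1 mulrC lerDl rnorm_ge0.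
Qed.

End WeakTopology.

(** * Peak functions *)

Section SupNorm.
Variables (R : realType) (T : topologicalType) (V : normedModType R[i]).
Implicit Types f : Cb T V.

Lemma Cb_continuous f : continuous f.
Proof. by have := Cb_funP f; rewrite inE => -[]. Qed.

Lemma Cb_rnorm_ge f t : rnorm (f t) <= rnorm f.
Proof. exact: Cb_norm_ub. Qed.

Lemma Cb_rnorm_le f (M : R) : 0 <= M -> (forall t, rnorm (f t) <= M) ->
  rnorm f <= M.
Proof. exact: Cb_norm_lub. Qed.

End SupNorm.

Section PeakFunctions.
Variables (R : realType) (T : topologicalType).
Local Notation C := (R[i]^o : normedModType R[i]).
Variable A : set (Cb T C).

Lemma closed_geometric_limit (q : R) (s : nat -> Cb T C) : 0 <= q < 1 ->
  closed A -> (forall n, A (s n)) ->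
  (forall n t, rnorm (s n.+1 t - s n t) <= (1 - q) * q ^+ n) ->
  exists2 f, A f & forall n t, rnorm (f t - s n t) <= 2 * q ^+ n.
Proof.
move=> q01 cA As ds; have q0 : 0 <= q by case/andP: q01.
have /choice[f fs] t := geometric_limit_complex q0 (ds^~ t).
have small (e : R) : 0 < e -> exists n : nat, 2 * q ^+ n < e.
  move=> e0; have [n] := exprn_small q01 (divr_gt0 e0 (ltr0n R 2)).
  by rewrite ltr_pdivlMr// mulrC; exists n.
have fP : f \in @bounded_continuous R T C.
  rewrite inE; split.
    apply/continuous_rnormP => t e e0.
    have [n ne] : exists n : nat, 2 * q ^+ n < e / 3 by apply: small; lra.
    have e3 : 0 < e / 3 by lra.
    have /continuous_rnormP/(_ t _ e3) := @Cb_continuous _ _ _ (s n).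
    apply: filterS => u su.
    have -> : f t - f u = (f t - s n t) + ((s n t - s n u) - (f u - s n u)).
      by ring.
    have := rnormD (V := C) (f t - s n t) ((s n t - s n u) - (f u - s n u)).
    have := rnormB (V := C) (s n t - s n u) (f u - s n u).
    by have := fs t n; have := fs u n; lra.
  apply/bounded_fun_rnorm; exists (2 + rnorm (s 0%N)) => t.
  rewrite -(subrK (s 0%N t) (f t)) (le_trans (rnormD (V := C) _ _))// lerD//.
    by have := fs t 0%N; rewrite expr0 mulr1.
  exact: Cb_rnorm_ge.
exists (MkCb fP) => [|n t]; last exact: fs.
apply: cA => B /nbhs_rnormP[e e0 eB]; have [n ne] := small _ e0.
exists (s n); split=> //; apply: eB; apply: le_lt_trans ne.
by apply: Cb_rnorm_le => [|t]; [rewrite mulr_ge0// exprn_ge0|exact: fs].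
Qed.

Hypothesis A_alg : function_algebra A.

Lemma function_algebra_linear (a : R[i]) f g : A f -> A g ->
  A (a *: f + g : Cb T C).
Proof.
by case: A_alg => -[_ +] _ _ _ Af Ag => /(_ a f g); rewrite !inE; apply.
Qed.

Lemma function_algebra0 : A 0.
Proof. by case: A_alg => -[+ _] _ _ _; rewrite inE. Qed.

Lemma function_algebra_exp f n : A f ->
  exists2 g, A g & forall t, g t = f t ^+ n.+1.
Proof.
move=> Af; elim: n => [|n [g Ag gE]]; first by exists f => // t; rewrite expr1.
case: A_alg => _ _ /(_ f g Af Ag)[h Ah hE] _.
by exists h => // t; rewrite hE gE [RHS]exprS.
Qed.

(** A high power of a peaking function is as small as desired away from the
    peak. *)
Lemma strong_boundary_peak w (U : set T) (d : R) : strong_boundary A w ->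
    open U -> U w -> 0 < d ->
  exists p, [/\ A p, p w = 1, forall t, rnorm (p t) <= 1 &
    forall t, ~ U t -> rnorm (p t) <= d].
Proof.
move=> /[apply] /[apply] -[f [Af fw f1 fU]] d0.
have fle t : rnorm (f t) <= 1.
  apply: le_trans (Cb_rnorm_ge f t) _.
  by rewrite -lecR -normE f1.
pose c := Num.max 0 (sup [set rnorm (f v) | v in ~` U]).
have c01 : 0 <= c < 1 by rewrite /c le_max lexx/= gt_max ltr01.
have [n cn] := exprn_small c01 d0.
have [p Ap pE] := function_algebra_exp n Af; exists p; split=> //.
- by rewrite pE fw expr1n.
- move=> t; rewrite pE; elim: n.+1 => [|m IH]; first by rewrite expr0 rnorm1.
  by rewrite exprS rnormM mulr_ile1 ?rnorm_ge0.
- move=> t tU; rewrite pE.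
  have ftc : rnorm (f t) <= c.
    rewrite /c le_max; apply/orP; right; apply: ub_le_sup; last by exists t.
    by exists 1 => _ [v _ <-].
  have fpow m : rnorm (f t ^+ m : R[i]^o) <= c ^+ m.
    elim: m => [|m IH]; first by rewrite !expr0 rnorm1.
    by rewrite !exprS rnormM ler_pM ?rnorm_ge0.
  apply: le_trans (fpow _) _; apply: le_trans (ltW cn).
  by rewrite exprS ler_piMl ?exprn_ge0//; case/andP: c01 => // _ /ltW.
Qed.

(** The partial sum [s] of a series of weighted peak functions at [w], after
    [n] terms. The total weight so far is [1 - r], the remaining weight is [r],
    and [N] is the neighbourhood of [w] on which the next function peaks. The
    last clause keeps some room for the terms to come, which are at most [d]
    times their weights outside of [N]. *)
Definition stolz_stage (w : T) (U : set T) (d : R) (n : nat) (s : Cb T C)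
    (N : set T) :=
  let r := (1 - d) ^+ n in
  [/\ A s, open N & N w] /\
  [/\ N `<=` U, s w = (1 - r)%:C, forall t, rnorm (s t) <= 1 - r &
      forall t, ~ U t -> rnorm (s t) <= d * (1 - r)] /\
  (forall t, N t -> rnorm (1 - s t : C) <= (1 + d) * r) /\
  (forall t, ~ N t ->
    rnorm (s t) + (1 - 5 * d) * rnorm (1 - s t : C) + 2 * d * r <= 1).

Lemma stolz_stage0 w (U : set T) (d : R) : open U -> U w ->
  0 < d -> stolz_stage w U d 0 0 U.
Proof.
move=> oU Uw d0; rewrite /stolz_stage expr0 subrr mulr0.
have n0 t : rnorm ((0 : Cb T C) t) = 0 by exact: rnorm0.
have n1 t : rnorm (1 - (0 : Cb T C) t : C) = 1.
  by rewrite [X in rnorm X]subr0; exact: rnorm1.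
split; first by split=> //; exact: function_algebra0.
split; first by split=> // t *; rewrite n0.
by split=> t _; rewrite ?n0 n1; lra.
Qed.

(** The next term has weight [d * r]. The new neighbourhood is the part of [N]
    where the new sum is close to its value at [w]; in the rest of [N] the old sum
    is close to [1 - r], so that the new term, whatever its argument, costs less
    than what the factor [1 - 5 * d] saves on [|1 - s|]. *)
Lemma stolz_stageS w (U : set T) (d : R) n s N : strong_boundary A w ->
  0 < d -> 5 * d <= 1 -> stolz_stage w U d n s N ->
  exists s' N', stolz_stage w U d n.+1 s' N' /\
    forall t, rnorm (s' t - s t) <= d * (1 - d) ^+ n.
Proof.
move=> wA d0 d5 [[As oN Nw]] [[NU sw s1 sU]] [sN sN'].
have [p [Ap pw p1 pN]] := strong_boundary_peak wA oN Nw d0.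
move: sw s1 sU sN sN'; rewrite /stolz_stage exprS.
set r := (1 - d) ^+ n => sw s1 sU sN sN'.
have r0 : 0 <= r by rewrite exprn_ge0//; lra.
have dr0 : 0 <= d * r by rewrite mulr_ge0// ltW.
(* the monomials that the linear arithmetic below has to compare *)
have ddr0 : 0 <= d * (d * r) by rewrite mulr_ge0// ltW.
have dddr0 : 0 <= d * (d * (d * r)) by rewrite mulr_ge0// ltW.
pose s' : Cb T C := (d * r)%:C *: p + s.
have s'E t : s' t = (d * r)%:C * p t + s t by [].
have dp t : rnorm ((d * r)%:C * p t : C) = d * r * rnorm (p t).
  by rewrite rnormM rnorm_nneg.
have s'w : s' w = (1 - (1 - d) * r)%:C.
  rewrite s'E pw sw mulr1 -rmorphD; congr (_%:C); ring.
have s'le t : rnorm (s' t) <= d * r * rnorm (p t) + rnorm (s t).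
  by rewrite s'E -dp; exact: (rnormD (V := C)).
have s'le1 t : rnorm (1 - s' t : C) <= rnorm (1 - s t : C) + d * r * rnorm (p t).
  rewrite s'E -dp (addrC (_ * _)) opprD addrA; exact: (rnormB (V := C)).
have dp1 t : d * r * rnorm (p t) <= d * r by rewrite ler_piMr.
have dpN t : ~ N t -> d * r * rnorm (p t) <= d * r * d.
  by move=> /pN; exact: ler_wpM2l.
have d50 : 0 <= 1 - 5 * d by lra.
have r_gt0 : 0 < r by rewrite exprn_gt0//; lra.
have qr0 : 0 < d * ((1 - d) * r) by rewrite !mulr_gt0//; lra.
have s'wc : continuous (fun t => s' t - s' w : C).
  by move=> t; apply: cvgB; [exact: Cb_continuous|exact: cvg_cst].
have ddrE : d * r * d = d * (d * r) by ring.
exists s', (N `&` [set t | rnorm (s' t - s' w : C) < d * ((1 - d) * r)]).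
split; last first.
  by move=> t; rewrite s'E addrK dp.
split; first split.
- exact: function_algebra_linear.
- by apply: openI => //; exact: open_rnorm_lt.
- by split=> //=; rewrite subrr rnorm0.
split; first split.
- by move=> t [/NU].
- exact: s'w.
- by move=> t; have := s'le t; have := dp1 t; have := s1 t; lra.
- move=> t tU; have := s'le t; have := dpN t (fun Nt => tU (NU _ Nt)).
  by have := sU t tU; rewrite ddrE; lra.
split=> t.
  move=> [_ /= st]; have -> : 1 - s' t = (1 - s' w) - (s' t - s' w).
    by rewrite opprB addrA subrK.
  apply: le_trans (rnormB (V := C) _ _) _; rewrite [X in 1 - X]s'w.
  rewrite -[1]/(1%:C) -rmorphB /= opprB addrCA subrr addr0 rnorm_nneg; last first.
    by rewrite mulr_ge0//; lra.
  by rewrite [leRHS]mulrDl mul1r lerD2l ltW.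
move=> stN'; have [Nt|tN] := pselect (N t).
  have le1 : rnorm (1 - s' t : C) <= (1 + d) * r + d * r.
    by have := s'le1 t; have := sN t Nt; have := dp1 t; lra.
  have := ler_wpM2l d50 le1.
  by have := s'le t; have := dp1 t; have := s1 t; lra.
have := ler_wpM2l d50 (s'le1 t).
have := ler_wpM2l d50 (dpN t tN).
by have := s'le t; have := dpN t tN; have := sN' t tN; rewrite ddrE; lra.
Qed.

(** Urysohn's lemma for function algebras. The convex set
    [|z| + (1 - e) |1 - z| <= 1] has a corner at [1] and contains a neighbourhood
    of every other point of the segment from [0] to [1]. The function is a sum of
    peak functions with geometric weights, each peaking where the sum of the
    previous ones is already close to its value at [w]. At a given point only one
    term is out of control: the terms before it are close to their weights and
    those after it are small. As its weight is a small fraction of the remaining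
    weight, hence of the distance to [1], the sum cannot leave the set. *)
Lemma stolz_peak w (U : set T) (e : R) : strong_boundary A w ->
    open U -> U w -> 0 < e < 1 ->
  exists f, [/\ A f, f w = 1,
    forall t, rnorm (f t) + (1 - e) * rnorm (1 - f t : C) <= 1 &
    forall t, ~ U t -> rnorm (f t) <= e].
Proof.
move=> wA oU Uw /andP[e0 e1]; pose d := e / 5.
have d0 : 0 < d by rewrite divr_gt0.
have d5 : 5 * d = e by rewrite mulrC divfK.
have d51 : 5 * d <= 1 by rewrite d5 ltW.
pose stage := {x : nat * (Cb T C * set T) | stolz_stage w U d x.1 x.2.1 x.2.2}.
pose next (x y : stage) := (sval y).1 = (sval x).1.+1 /\
  forall t, rnorm ((sval y).2.1 t - (sval x).2.1 t) <= d * (1 - d) ^+ (sval x).1.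
have nextP x : {y | next x y}.
  apply/cid; case: x => [[n [s N]] /= sN].
  have [s' [N' [sN' ss']]] := stolz_stageS wA d0 d51 sN.
  by exists (exist _ (n.+1, (s', N')) sN').
have [F [F0 FS]] := dependent_choice nextP
  (exist _ (0%N, (0, U)) (stolz_stage0 oU Uw d0)).
have Fn n : (sval (F n)).1 = n.
  by elim: n => [|n IH]; [rewrite F0|rewrite (FS n).1 IH].
pose s n := (sval (F n)).2.1.
have sP n : exists N, stolz_stage w U d n (s n) N.
  by exists (sval (F n)).2.2; have := svalP (F n); rewrite Fn.
have q01 : 0 <= 1 - d < 1 by apply/andP; split; lra.
have cA : closed A by case: A_alg.
have sA n : A (s n) by have [N [[]]] := sP n.
have sS n t : rnorm (s n.+1 t - s n t) <= (1 - (1 - d)) * (1 - d) ^+ n.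
  by rewrite subKr; have := (FS n).2 t; rewrite Fn.
have [f Af fs] := closed_geometric_limit q01 cA sA sS.
(* the error [2 (1 - d) ^+ n] of [fs] enters at most twice; [6] leaves room *)
have lim (a b : R) : (forall n, a <= b + 6 * (1 - d) ^+ n) -> a <= b.
  move=> ab; apply/ler_addgt0Pr => x x0.
  have [n] := exprn_small q01 (divr_gt0 x0 (ltr0n R 6)).
  by rewrite ltr_pdivlMr// => nx; have := ab n; lra.
have fst n t : rnorm (f t) <= rnorm (s n t) + 2 * (1 - d) ^+ n.
  rewrite -(subrK (s n t) (f t)) addrC.
  by apply: le_trans (rnormD (V := C) _ _) _; rewrite lerD2l fs.
have q_ge0 n : 0 <= (1 - d) ^+ n by rewrite exprn_ge0//; lra.
exists f; split=> //.
- apply/eqP; rewrite -subr_eq0; apply/eqP/(rnorm0_eq0 (V := C)).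
  apply/eqP; rewrite eq_le rnorm_ge0 andbT; apply: lim => n; rewrite add0r.
  have [N [_ [[_ sw _ _] _]]] := sP n.
  have -> : f w - 1 = (f w - s n w) - (1 - s n w) by rewrite opprB addrA subrK.
  apply: le_trans (rnormB (V := C) _ _) _; rewrite [X in 1 - X]sw.
  rewrite -[1]/(1%:C) -rmorphB /= opprB addrCA subrr addr0 rnorm_nneg//.
  by have := fs n w; have := q_ge0 n; lra.
- move=> t; apply: lim => n; have [N [_ [[_ _ s1 _] [sN sN']]]] := sP n.
  have f1 : rnorm (1 - f t : C) <= rnorm (1 - s n t : C) + 2 * (1 - d) ^+ n.
    have -> : 1 - f t = (1 - s n t) - (f t - s n t) by rewrite opprB addrA subrK.
    by apply: le_trans (rnormB (V := C) _ _) _; rewrite lerD2l fs.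
  have e10 : 0 <= 1 - e by lra.
  have := ler_wpM2l e10 f1; have := fst n t; have := q_ge0 n.
  have er0 : 0 <= e * (1 - d) ^+ n by rewrite mulr_ge0// ltW.
  have dr0 : 0 <= d * (1 - d) ^+ n by rewrite mulr_ge0// ltW.
  have [/sN|/sN'] := pselect (N t).
    move=> s1'; have := ler_wpM2l e10 s1'; have := s1 t.
    have edr0 : 0 <= e * (d * (1 - d) ^+ n) by rewrite mulr_ge0// ltW.
    have : d * (1 - d) ^+ n = e * (1 - d) ^+ n / 5 by rewrite mulrAC.
    by lra.
  by rewrite d5; lra.
- move=> t tU; apply: lim => n; have [N [_ [[_ _ _ sU] _]]] := sP n.
  have := fst n t; have := sU t tU; have := q_ge0 n.
  have dr0 : 0 <= d * (1 - d) ^+ n by rewrite mulr_ge0// ltW.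
  by rewrite -d5; lra.
Qed.

End PeakFunctions.

(** * Prescribing values at strong boundary points *)

Section DisjointNeighbourhoods.
Variables (T : topologicalType).

Lemma disjoint_neighbourhoods (S : set T) N : hausdorff_space T ->
  infinite_set S ->
  exists (w : 'I_N -> T) (U : 'I_N -> set T),
    (forall i, [/\ S (w i), open (U i) & U i (w i)]) /\
    (forall i j t, i != j -> U i t -> ~ U j t).
Proof.
move=> hT /(infinite_set_fset N)[B BS NB].
have lt_ord (i : 'I_N) : (i < size (finmap.enum_fset B))%N.
  exact: leq_trans (ltn_ord i) NB.
pose w (i : 'I_N) := tnth (in_tuple (finmap.enum_fset B)) (Ordinal (lt_ord i)).
have w_inj (i j : 'I_N) : i != j -> w i != w j.
  by move=> ij; rewrite /w !(tnth_nth (w i))/= nth_uniq ?finmap.fset_uniq.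
have Sw i : S (w i) by apply: BS; rewrite /= /w mem_tnth.
have sep (ij : 'I_N * 'I_N) : exists PQ : set T * set T, ij.1 != ij.2 ->
    [/\ open PQ.1, open PQ.2, PQ.1 (w ij.1), PQ.2 (w ij.2) &
        forall t, PQ.1 t -> ~ PQ.2 t].
  have [_|ij_neq] := eqVneq; first by exists (set0, set0).
  move: hT; rewrite open_hausdorff => /(_ _ _ (w_inj _ _ ij_neq)).
  move=> [[P Q] /= [/set_mem Pw /set_mem Qw] [oP oQ PQ0]].
  exists (P, Q) => _; split=> // t Pt Qt.
  by have : (P `&` Q) t by []; move: PQ0 => /eqP ->.
(* [sep] separates the two orders of a pair independently; taking both
   separations makes the construction symmetric *)
have /choice[D DP] := sep.
pose G i := [set t | forall j, j != i -> (D (i, j)).1 t /\ (D (j, i)).2 t].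
exists w, (fun i => interior (G i)); split=> [i|i j t ij].
  split; [exact: Sw|exact: open_interior|].
  apply: (@filter_forall T 'I_N (fun j t => j != i ->
    (D (i, j)).1 t /\ (D (j, i)).2 t) (nbhs (w i)) _) => j.
  have [->|ji] := eqVneq j i; first exact: nearW.
  have [|o1 _ O1 _ _] := DP (i, j); first by rewrite /= eq_sym.
  have [|_ o2 _ O2 _] := DP (j, i); first by [].
  have n1 : nbhs (w i) (D (i, j)).1 by apply: open_nbhs_nbhs.
  have n2 : nbhs (w i) (D (j, i)).2 by apply: open_nbhs_nbhs.
  by apply: filterS2 n1 n2 => t; split.
move=> /interior_subset Git /interior_subset Gjt.
have [|_ _ _ _ disj] := DP (i, j); first by [].
by apply: (disj t); [case: (Git j _) => //; rewrite eq_sym|case: (Gjt i _)].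
Qed.

End DisjointNeighbourhoods.

Section Modification.
Variables (R : realType) (T : topologicalType) (X : normedModType R[i]).
Variables (A : set (Cb T R[i]^o)) (AX : closed_subspace (Cb T X)).
Hypotheses (A_alg : function_algebra A) (AX_alg : vector_function_algebra AX)
  (AX_base : base_algebra AX = A).
Local Notation E := (banach_subspace AX).
Implicit Types (f g : E) (t w : T).

Definition eval_at t f : X := Cb_fun (subspace_val f) t.

Lemma eval_atD t f g : eval_at t (f + g) = eval_at t f + eval_at t g.
Proof.
have valD (u v : E) : subspace_val (u + v) = subspace_val u + subspace_val v by [].
have funD (u v : Cb T X) : Cb_fun (u + v) t = u t + v t by [].
by rewrite /eval_at valD funD.
Qed.

Lemma eval_atZ t (a : R[i]) f : eval_at t (a *: f) = a *: eval_at t f.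
Proof.
have valZ (u : E) : subspace_val (a *: u) = a *: subspace_val u by [].
have funZ (u : Cb T X) : Cb_fun (a *: u) t = a *: u t by [].
by rewrite /eval_at valZ funZ.
Qed.

Lemma eval_at_linear t : linear (eval_at t).
Proof. by move=> a f g; rewrite eval_atD eval_atZ. Qed.

HB.instance Definition _ t := GRing.isLinear.Build R[i] E X _ (eval_at t)
  (eval_at_linear t).

Lemma eval_atB t f g : eval_at t (f - g) = eval_at t f - eval_at t g.
Proof. by rewrite -scaleN1r eval_atD eval_atZ scaleN1r. Qed.

Lemma eval_at_sum t (I : Type) (r : seq I) (f : I -> E) :
  eval_at t (\sum_(i <- r) f i) = \sum_(i <- r) eval_at t (f i).
Proof.
apply: (big_morph (eval_at t)) => [g h|]; first exact: eval_atD.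
by rewrite -(scale0r (0 : E)) eval_atZ scale0r.
Qed.

Lemma rnorm_eval_at t f : rnorm (eval_at t f) <= rnorm f.
Proof. exact: Cb_rnorm_ge. Qed.

Lemma rnorm_eval_le f (M : R) : 0 <= M ->
  (forall t, rnorm (eval_at t f) <= M) -> rnorm f <= M.
Proof. exact: Cb_rnorm_le. Qed.

Lemma subspace_mul (phi : Cb T R[i]^o) f : A phi ->
  exists h : E, forall t, eval_at t h = (phi t : R[i]) *: eval_at t f.
Proof.
rewrite -AX_base => Aphi; case: AX_alg => _ _ /(_ phi (subspace_val f) Aphi).
have := subspace_valP f; rewrite inE => fA /(_ fA)[h hA hE].
have hP : h \in subspace_pred AX by rewrite inE.
by exists (MkBanachSubspace hP) => t; rewrite /eval_at /= hE.
Qed.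

Lemma subspace_scale (phi : Cb T R[i]^o) (x : X) : A phi ->
  exists h : E, forall t, eval_at t h = (phi t : R[i]) *: x.
Proof.
rewrite -AX_base => Aphi; case: AX_alg => _ /(_ phi x Aphi)[h hA hE] _.
have hP : h \in subspace_pred AX by rewrite inE.
by exists (MkBanachSubspace hP) => t; rewrite /eval_at /= hE.
Qed.

(** The function is [(1 - d) (1 - phi) f + phi x]. It stays in the unit ball by
    the condition on [phi], and it differs from [f] by
    [phi (x - f) - d (1 - phi) f]. *)
Lemma prescribe_value f (x : X) (phi : Cb T R[i]^o) (d : R) w :
    rnorm f <= 1 -> rnorm x <= 1 -> 0 < d < 1 -> A phi -> phi w = 1 ->
    (forall t, rnorm (phi t) + (1 - d) * rnorm (1 - phi t : R[i]^o) <= 1) ->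
  exists f', [/\ rnorm f' <= 1, eval_at w f' = x &
    forall t, rnorm (eval_at t (f' - f)) <= 2 * rnorm (phi t) + 2 * d].
Proof.
move=> f1 x1 /andP[d0 d1] Aphi phiw stolz.
have [h1 h1E] := subspace_mul f Aphi.
have [h2 h2E] := subspace_scale x Aphi.
have ft t : rnorm (eval_at t f) <= 1 by exact: le_trans (rnorm_eval_at t f) f1.
have fphi t : eval_at t (f - h1) = (1 - phi t : R[i]) *: eval_at t f.
  by rewrite eval_atB h1E scalerBl scale1r.
have fphi1 t : rnorm (eval_at t (f - h1)) <= rnorm (1 - phi t : R[i]^o).
  by rewrite fphi rnormZ ler_piMr ?rnorm_ge0.
have d10 : 0 <= 1 - d by lra.
pose f' : E := (1 - d)%:C *: (f - h1) + h2.
have f'E t : eval_at t f' =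
    (1 - d)%:C *: eval_at t (f - h1) + (phi t : R[i]) *: x.
  by rewrite /f' [LHS]eval_atD eval_atZ h2E.
exists f'; split.
- apply: rnorm_eval_le => // t; apply: le_trans (stolz t).
  rewrite f'E (le_trans (rnormD _ _))// addrC lerD//.
    by rewrite rnormZ ler_piMr ?rnorm_ge0.
  by rewrite rnormZ rnorm_nneg// ler_wpM2l.
- by rewrite f'E fphi phiw subrr scale0r scaler0 add0r scale1r.
- move=> t.
  have -> : eval_at t (f' - f) =
      (phi t : R[i]) *: (x - eval_at t f) - d%:C *: eval_at t (f - h1).
    rewrite eval_atB f'E rmorphB/= scalerBl scale1r [in RHS]scalerBr.
    set v := d%:C *: _; set c := _ *: x; rewrite eval_atB h1E.
    set a := eval_at t f; set b := _ *: a.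
    rewrite (addrAC _ c) (addrAC _ (- v)) (addrAC _ (- b)) subrr add0r.
    rewrite addrC.
    by rewrite addrA.
  rewrite (le_trans (rnormB _ _))// lerD//.
    rewrite rnormZ mulrC ler_wpM2r ?rnorm_ge0//.
    by rewrite (le_trans (rnormB _ _))//; have := ft t; lra.
  rewrite rnormZ rnorm_nneg ?(ltW d0)// mulrC ler_wpM2r ?(ltW d0)//.
  apply: le_trans (fphi1 t) _; apply: le_trans (rnormB (V := R[i]^o) _ _) _.
  rewrite [X in X + _]rnorm1; have := stolz t.
  have := mulr_ge0 d10 (rnorm_ge0 (1 - phi t : R[i]^o)); lra.
Qed.

(** Absolute summability, in the form that suits spaces of functions: for many
    functions with almost disjoint supports, the bound [K] does not depend on
    their number. *)
Definition summing (q : E -> R) := exists2 M : R, 0 <= M &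
  forall n (g : 'I_n -> E) (K : R), 0 <= K ->
    (forall t, \sum_(k < n) rnorm (eval_at t (g k)) <= K) ->
    \sum_(k < n) q (g k) <= M * K.

(** After rotations of the [g k], the sum of the moduli of the values of [l] is
    the value of [l] at one function, of norm at most [K]. *)
Lemma summing_functional (l : {linear E -> R[i]^o}) (M : R) : 0 <= M ->
  (forall g, rnorm (l g : R[i]^o) <= M * rnorm g) ->
  summing (fun g => rnorm (l g : R[i]^o)).
Proof.
move=> M0 lM; exists M => // n g K K0 gK.
have /choice[c cP] : forall k : 'I_n, exists c : R[i],
    rnorm (c : R[i]^o) <= 1 /\ c * l (g k) = (rnorm (l (g k) : R[i]^o))%:C.
  by move=> k; have [c c1 cE] := complex_sign (l (g k)); exists c.
pose h := \sum_(k < n) c k *: g k.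
have hK : rnorm h <= K.
  apply: rnorm_eval_le => // t; rewrite eval_at_sum.
  apply: le_trans (rnorm_sum _ _ _) _; apply: le_trans (gK t).
  apply: ler_sum => k _; rewrite eval_atZ rnormZ ler_piMl ?rnorm_ge0//.
  by have [] := cP k.
have lh : l h = (\sum_(k < n) rnorm (l (g k) : R[i]^o))%:C.
  rewrite linear_sum rmorph_sum; apply: eq_bigr => k _.
  by rewrite linearZ; exact: (cP k).2.
have := lM h; rewrite lh rnorm_nneg; last first.
  by apply: sumr_ge0 => k _; exact: rnorm_ge0.
by move=> /le_trans; apply; rewrite ler_wpM2l.
Qed.

Lemma summing_sum (I : Type) (r : seq I) (q : I -> E -> R) :
  (forall i, summing (q i)) -> summing (fun g => \sum_(i <- r) q i g).
Proof.
move=> qS; elim: r => [|i r [M M0 MP]].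
  exists 0 => // n g K _ _; rewrite mul0r big1// => k _.
  by rewrite big_nil.
have [N N0 NP] := qS i; exists (N + M) => [|n g K K0 gK]; first exact: addr_ge0.
under eq_bigr do rewrite big_cons.
by rewrite big_split/= mulrDl lerD// ?NP ?MP.
Qed.

(** Of many modifications of the [f i] supported near distinct points, one is
    small for the given summing quantities, since the sum of all of them is
    bounded. *)
Lemma prescribe_value_nearby (S : set T) (I : finType) (f : I -> E)
    (q : I -> E -> R) (x : X) (e : R) :
  hausdorff_space T -> infinite_set S -> S `<=` strong_boundary A ->
  (forall i, rnorm (f i) <= 1) -> (forall i, summing (q i)) ->
  rnorm x <= 1 -> 0 < e ->
  exists w (f' : I -> E), [/\ S w, forall i, rnorm (f' i) <= 1,
    forall i, eval_at w (f' i) = x & \sum_i q i (f' i - f i) < e].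
Proof.
move=> hT Sinf SA f1 qS x1 e0.
have /choice[M MP] : forall i, exists M : R, 0 <= M /\
    forall n (g : 'I_n -> E) (K : R), 0 <= K ->
      (forall t, \sum_(k < n) rnorm (eval_at t (g k)) <= K) ->
      \sum_(k < n) q i (g k) <= M * K.
  by move=> i; have [M M0 MP] := qS i; exists M.
(* the differences [f' k i - f i] are at most [2 |phi k| + 2 d] in modulus; with
   [d = 1 / N], and [sum_k |phi k| <= 2] since at most one of the [phi k] is not
   small, they sum up to at most [6] at every point *)
pose N := (Num.truncn ((\sum_i M i * 6) / e)).+2.
have Ne : \sum_i M i * 6 < N%:R * e.
  rewrite -ltr_pdivrMr// (lt_le_trans (truncnS_gt _))//.
  by rewrite ler_nat.
have N0 : 0 < N%:R :> R by rewrite ltr0n.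
pose d : R := N%:R^-1.
have d01 : 0 < d < 1 by rewrite invr_gt0 N0 invf_lt1// ltr1n.
have [w [U [wU Udisj]]] := disjoint_neighbourhoods N hT Sinf.
have /choice[phi phiP] : forall k : 'I_N, exists phi, [/\ A phi, phi (w k) = 1,
    forall t, rnorm (phi t) + (1 - d) * rnorm (1 - phi t : R[i]^o) <= 1 &
    forall t, ~ U k t -> rnorm (phi t) <= d].
  by move=> k; have [Sw oU Uw] := wU k; apply: stolz_peak => //; exact: SA.
have d10 : 0 <= 1 - d by case/andP: d01; lra.
have phi1 k t : rnorm (phi k t) <= 1.
  have [_ _ /(_ t) h _] := phiP k.
  by have := mulr_ge0 d10 (rnorm_ge0 (1 - phi k t : R[i]^o)); lra.
have Nd : \sum_(k < N) d = 1.
  by rewrite sumr_const card_ord -mulr_natl divff// gt_eqF.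
have phi_sum t : \sum_(k < N) rnorm (phi k t) <= 2.
  have d0 : 0 <= d by case/andP: d01 => /ltW.
  have [[k0 Uk0]|noU] := pselect (exists k, U k t).
    rewrite (bigD1 k0)//= -[2]/(1 + 1 : R) lerD// -Nd [leRHS](bigD1 k0)//=.
    rewrite -[leLHS]add0r lerD//; apply: ler_sum => k kk0.
    have [_ _ _] := phiP k; apply; apply: (Udisj k0) => //.
    by rewrite eq_sym.
  rewrite (le_trans (_ : _ <= 1))// ?ler1n// -Nd; apply: ler_sum => k _.
  by have [_ _ _] := phiP k; apply => Uk; apply: noU; exists k.
have /choice[f' fP] : forall k, exists f' : I -> E, forall i,
    [/\ rnorm (f' i) <= 1, eval_at (w k) (f' i) = x &
    forall t, rnorm (eval_at t (f' i - f i)) <= 2 * rnorm (phi k t) + 2 * d].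
  move=> k; have [Aphi phiw stolz _] := phiP k.
  have /choice[f' fP] i := prescribe_value (f1 i) x1 d01 Aphi phiw stolz.
  by exists f'.
have total : \sum_(k < N) \sum_i q i (f' k i - f i) < N%:R * e.
  rewrite exchange_big/=; apply: le_lt_trans Ne; apply: ler_sum => i _.
  apply: (MP i).2 => // t.
  apply: le_trans (_ : \sum_(k < N) (2 * rnorm (phi k t) + 2 * d) <= _).
    by apply: ler_sum => k _; have [_ _] := fP k i; apply.
  rewrite big_split/= -!mulr_sumr Nd; have := phi_sum t; lra.
have [k kP] : exists k : 'I_N, \sum_i q i (f' k i - f i) < e.
  apply/not_existsP => ge_e; move: total; rewrite ltNge => /negP; apply.
  have -> : N%:R * e = \sum_(k < N) e by rewrite sumr_const card_ord mulr_natl.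
  by apply: ler_sum => k _; rewrite leNgt; apply/negP; exact: ge_e.
exists (w k), (f' k); split=> // [|i|i]; first by have [] := wU k.
- by have [] := fP k i.
- by have [] := fP k i.
Qed.

End Modification.

(** * The projective tensor product *)

Section ProjectiveTensor.
Variables (R : realType) (E F : normedModType R[i]).

Definition tensor_cost (s : seq (E * F)) : R :=
  \sum_(p <- s) rnorm p.1 * rnorm p.2.

Lemma tensor_cost_ge0 s : 0 <= tensor_cost s.
Proof. by apply: sumr_ge0 => p _; rewrite mulr_ge0 ?rnorm_ge0. Qed.

Lemma projective_norm_le s s' : tensor_eq s s' ->
  projective_norm s <= tensor_cost s'.
Proof.
move=> ss'; apply: ge_inf; last by exists s'.
by exists 0 => _ [s'' _ <-]; exact: tensor_cost_ge0.
Qed.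

Lemma bilinear_le_projective_norm (b : {bilinear E -> F -> R[i]^o}) s :
  (forall e f, rnorm (b e f : R[i]^o) <= rnorm e * rnorm f) ->
  rnorm (tensor_eval b s : R[i]^o) <= projective_norm s.
Proof.
move=> b1; apply: lb_le_inf.
  by exists (tensor_cost s); exists s.
move=> _ [s' ss' <-]; rewrite (ss' b) (le_trans (rnorm_sum _ _ _))//.
by apply: ler_sum => p _; exact: b1.
Qed.

Lemma projective_norm_near s (e : R) : 0 < e ->
  exists2 s', tensor_eq s s' & tensor_cost s' < projective_norm s + e.
Proof.
move=> e0.
have [|_ [s' ss' <-] lt_s'] := @inf_adherent R
  [set tensor_cost s' | s' in tensor_eq s] e e0.
  split; first by exists (tensor_cost s); exists s.
  by exists 0 => _ [s'' _ <-]; exact: tensor_cost_ge0.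
by exists s'.
Qed.

Variables (Z : completeNormedModType R[i]) (t : {bilinear E -> F -> Z}).
Hypothesis Z_tensor : is_projective_tensor_product t.

Lemma rnorm_tensor_eval s : rnorm (tensor_eval t s) = projective_norm s.
Proof. by case: Z_tensor. Qed.

Lemma rnorm_tensor_le e f : rnorm (t e f) <= rnorm e * rnorm f.
Proof.
have -> : t e f = tensor_eval t [:: (e, f)] by rewrite /tensor_eval big_seq1.
rewrite rnorm_tensor_eval; apply: le_trans (@projective_norm_le _ [:: (e, f)] _) _.
  by [].
by rewrite /tensor_cost big_seq1.
Qed.

Lemma tensor_eval_sub (W : lmodType R[i]) (b : {bilinear E -> F -> W}) s s' :
  tensor_eval b (s ++ [seq (- p.1, p.2) | p <- s']) =
  tensor_eval b s - tensor_eval b s'.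
Proof.
rewrite /tensor_eval big_cat/= big_map -sumrN; congr (_ + _).
by apply: eq_bigr => p _; rewrite linearNl.
Qed.

Lemma tensor_eq_eval s s' : tensor_eq s s' -> tensor_eval t s = tensor_eval t s'.
Proof.
move=> ss'; apply/eqP; rewrite -subr_eq0 -tensor_eval_sub; apply/eqP.
apply: rnorm0_eq0; apply/eqP; rewrite eq_le rnorm_ge0 andbT rnorm_tensor_eval.
apply: le_trans (@projective_norm_le _ [::] _) _; last by rewrite /tensor_cost big_nil.
by move=> b; rewrite tensor_eval_sub (ss' b) subrr /tensor_eval big_nil.
Qed.

(** A tensor close to [u] is a sum of elementary tensors of total cost [m] less
    than [1 + r / 2]. Normalizing the vectors turns the costs, divided by [m],
    into convex coefficients; the factor [m / c] left over is absorbed by the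
    first vectors. *)
Lemma unit_ball_approx u (r : R) : rnorm u <= 1 -> 0 < r ->
  exists n (a : 'I_n -> R) (f : 'I_n -> E) (y : 'I_n -> F),
  [/\ forall i, 0 <= a i, \sum_i a i = 1, forall i, rnorm (f i) <= 1,
      forall i, rnorm (y i) <= 1 &
      rnorm (\sum_i (a i)%:C *: t (f i) (y i) - u) < r].
Proof.
move=> u1 r0; have r3 : 0 < r / 4 by lra.
have [s su] : exists s, rnorm (tensor_eval t s - u) < r / 4.
  case: Z_tensor => _ dense.
  have : closure (range (tensor_eval t)) u by rewrite dense.
  have nu : nbhs u [set v | rnorm (v - u) < r / 4].
    by apply/nbhs_rnormP; exists (r / 4) => // v; rewrite rnormBC.
  by move=> /(_ _ nu)[_ [[s _ <-] ?]]; exists s.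
have s1 : projective_norm s < 1 + r / 4.
  rewrite -rnorm_tensor_eval -(subrK u (tensor_eval t s)).
  by apply: le_lt_trans (rnormD _ _) _; lra.
have [s' ss' s'1] := projective_norm_near s r3.
rewrite (tensor_eq_eval ss') in su; set m := tensor_cost s' in s'1.
have m0 : 0 <= m := tensor_cost_ge0 s'.
(* dividing by [c] brings the cost below one and moves the tensor by at most
   [c - 1 = r / 2] *)
pose c := 1 + r / 2.
have c0 : 0 < c by rewrite /c; lra.
have mc : m / c <= 1 by rewrite ler_pdivrMr// mul1r /c; lra.
suff [n [a [f [y [a0 a1 f1 y1 sumE]]]]] :
    exists n (a : 'I_n -> R) (f : 'I_n -> E) (y : 'I_n -> F),
    [/\ forall i, 0 <= a i, \sum_i a i = 1, forall i, rnorm (f i) <= 1,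
      forall i, rnorm (y i) <= 1 &
      \sum_i (a i)%:C *: t (f i) (y i) = (c^-1)%:C *: tensor_eval t s'].
  exists n, a, f, y; split=> //; rewrite {}sumE.
  set v := tensor_eval t s' in su *.
  have vle : rnorm v <= 1 + r / 4.
    by rewrite -(subrK u v); apply: le_trans (rnormD _ _) _; lra.
  have -> : (c^-1)%:C *: v - u = (v - u) - (1 - c^-1)%:C *: v.
    rewrite rmorphB/= scalerBl scale1r opprB [RHS]addrC addrA.
    by rewrite subrK.
  have c1 : 0 <= 1 - c^-1 by rewrite subr_ge0 invf_le1// /c; lra.
  apply: le_lt_trans (rnormB _ _) _; rewrite rnormZ rnorm_nneg//.
  have vc : (1 - c^-1) * rnorm v <= (1 - c^-1) * c.
    by rewrite ler_wpM2l// (le_trans vle)// /c; lra.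
  have : (1 - c^-1) * c = r / 2 by rewrite mulrBl mulVf ?gt_eqF// /c; lra.
  lra.
move: m0; rewrite le_eqVlt => /orP[/eqP m0|m_gt0].
  exists 1%N, (fun=> 1), (fun=> 0), (fun=> 0); split=> // [|i|i|]; rewrite ?rnorm0//.
  - by rewrite big_ord1.
  - rewrite big_ord1 linear0r scaler0 [tensor_eval t s']rnorm0_eq0 ?scaler0//.
    apply/eqP; rewrite eq_le rnorm_ge0 andbT rnorm_tensor_eval.
    by apply: le_trans (@projective_norm_le _ s' _) _ => //; rewrite -/m -m0.
pose p (i : 'I_(size s')) := nth (0, 0) s' i.
have sumE (W : nmodType) (G : E * F -> W) : \sum_(q <- s') G q = \sum_i G (p i).
  by rewrite (big_nth (0, 0)) big_mkord.
have cancel (V : normedModType R[i]) (v : V) :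
    (rnorm v)%:C *: ((rnorm v)^-1%:C *: v) = v.
  have [/rnorm0_eq0->|v0] := eqVneq (rnorm v) 0; first by rewrite !scaler0.
  by rewrite scalerA -rmorphM/= divff// scale1r.
have unit (V : normedModType R[i]) (v : V) : rnorm ((rnorm v)^-1%:C *: v) <= 1.
  rewrite rnormZ rnorm_nneg ?invr_ge0 ?rnorm_ge0//.
  have [->|v0] := eqVneq (rnorm v) 0; first by rewrite mulr0 ler01.
  by rewrite mulVf.
exists (size s'), (fun i => rnorm (p i).1 * rnorm (p i).2 / m),
  (fun i => (m / c)%:C *: ((rnorm (p i).1)^-1%:C *: (p i).1)),
  (fun i => (rnorm (p i).2)^-1%:C *: (p i).2).
have mc0 : 0 <= m / c by rewrite divr_ge0// ltW.
split=> [i||i|i|].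
- by rewrite divr_ge0 ?mulr_ge0 ?rnorm_ge0// ltW.
- rewrite -mulr_suml -(sumE _ (fun q => rnorm q.1 * rnorm q.2)).
  by rewrite divff// gt_eqF.
- by rewrite rnormZ rnorm_nneg// mulr_ile1 ?rnorm_ge0.
- exact: unit.
- rewrite /tensor_eval sumE scaler_sumr; apply: eq_bigr => i _.
  set v := _ *: (p i).1; set w := _ *: (p i).2.
  have -> : t (p i).1 (p i).2 = (rnorm (p i).1 * rnorm (p i).2)%:C *: t v w.
    rewrite -{1}(cancel _ (p i).1) -{1}(cancel _ (p i).2) -/v -/w.
    by rewrite linearZl_LR/= linearZr_LR/= -scale_realM.
  rewrite (linearZl_LR t w (m / c)%:C v) -!scale_realM.
  congr (_%:C *: _); field; by rewrite !gt_eqF.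
Qed.

End ProjectiveTensor.

(** * Convex combinations of tensors lying over a face *)

Lemma dual_norm1_le (R : realType) (V : normedModType R[i]) (l : topdual V) :
  dual_norm l = 1 -> forall v, rnorm (l v : R[i]^o) <= rnorm v.
Proof.
move=> l1 v; have [v0|v0] := eqVneq (rnorm v) 0.
  by rewrite (rnorm0_eq0 v0) linear0 !rnorm0.
have nv : 0 < rnorm v by rewrite lt_neqAle eq_sym v0 rnorm_ge0.
have [M M0 lM] := topdual_bounded l.
have : rnorm (l ((rnorm v)^-1%:C *: v) : R[i]^o) <= 1.
  rewrite -l1; apply: ub_le_sup.
    exists M => _ [u + <-]; rewrite unit_ballE => u1.
    apply: le_trans (lM u) _; exact: ler_piMr.
  exists ((rnorm v)^-1%:C *: v) => //; rewrite unit_ballE rnormZ.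
  by rewrite rnorm_nneg ?invr_ge0 ?(ltW nv)// mulVf.
by rewrite linearZ rnormZ rnorm_nneg ?invr_ge0 ?(ltW nv)// ler_pdivrMl// mulr1.
Qed.

(** The moduli of the coefficients, divided by their sum [m], become the convex
    coefficients, and [m] times the signs become the scalars; when [m] is zero a
    point of [S] is still needed, with scalar zero. *)
Lemma aconvP (R : realType) (V : normedModType R[i]) (S : set V) x :
  S !=set0 -> aconv S x ->
  exists n (a : 'I_n -> R) (c : 'I_n -> R[i]) (v : 'I_n -> V),
  [/\ forall j, 0 <= a j, \sum_j a j = 1, forall j, rnorm (c j : R[i]^o) <= 1,
      forall j, S (v j) & x = \sum_j (a j)%:C *: (c j *: v j)].
Proof.
move=> [v0 Sv0] [n [l [v [l1 Sv ->]]]].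
pose m := \sum_(j < n) rnorm (l j : R[i]^o).
have m1 : m <= 1.
  rewrite -(@lecR R) rmorph_sum; apply: le_trans l1.
  by apply: ler_sum => j _; rewrite (normE (l j : R[i]^o)).
have [m0|m_neq0] := eqVneq m 0.
  have l0 j : l j = 0.
    apply: (rnorm0_eq0 (V := R[i]^o)); move/eqP: m0; rewrite psumr_eq0.
      by move=> /allP/(_ j (mem_index_enum j))/eqP.
    by move=> k _; exact: rnorm_ge0.
  exists 1%N, (fun=> 1), (fun=> 0), (fun=> v0).
  split=> // [|j|]; first by rewrite big_ord1.
    by rewrite rnorm0.
  rewrite big_ord1 scale0r scaler0 big1// => j _.
  by rewrite l0 scale0r.
have m0 : 0 < m.
  by rewrite lt_neqAle eq_sym m_neq0 sumr_ge0// => k _; exact: rnorm_ge0.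
exists n, (fun j => rnorm (l j : R[i]^o) / m),
  (fun j => m%:C * (l j / (rnorm (l j : R[i]^o))%:C)), v.
split=> // [j||j|].
- by rewrite divr_ge0 ?rnorm_ge0// ltW.
- by rewrite -mulr_suml divff.
- rewrite rnormM rnorm_nneg ?(ltW m0)// mulr_ile1 ?rnorm_ge0 ?(ltW m0)//.
  have [->|l0] := eqVneq (l j) 0; first by rewrite mul0r rnorm0.
  suff -> : rnorm (l j / (rnorm (l j : R[i]^o))%:C : R[i]^o) = 1 by [].
  apply: complexI; rewrite -!normE normrM normfV normr_id divff//.
  by rewrite normr_eq0.
- apply: eq_bigr => j _; rewrite scalerA; congr (_ *: _).
  have [->|l0] := eqVneq (l j) 0; first by rewrite mul0r !mulr0.
  have nl : (rnorm (l j : R[i]^o))%:C != 0 :> R[i].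
    by rewrite -normE normr_eq0.
  have mC : m%:C != 0 :> R[i] by rewrite -[0]/(0%:C) (inj_eq (@complexI R)).
  by rewrite rmorphM fmorphV mulrA divfK// mulrC divfK.
Qed.

Section FaceRepresentation.
Variables (R : realType) (E Y : normedModType R[i]).
Variables (Z : completeNormedModType R[i]) (t : {bilinear E -> Y -> Z}).
Hypothesis Z_tensor : is_projective_tensor_product t.

Definition tensor_combination (I : finType) (a : I -> R) (f : I -> E)
  (y : I -> Y) : Z := \sum_i (a i)%:C *: t (f i) (y i).

Lemma tensor_combinationBl (I : finType) (a : I -> R) (f f' : I -> E)
    (y : I -> Y) :
  tensor_combination a f y - tensor_combination a f' y =
  tensor_combination a (fun i => f i - f' i) y.
Proof.
rewrite /tensor_combination -sumrB; apply: eq_bigr => i _.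
by rewrite linearBl scalerBr.
Qed.

Lemma tensor_combinationBr (I : finType) (a : I -> R) (f : I -> E)
    (y y' : I -> Y) :
  tensor_combination a f y - tensor_combination a f y' =
  tensor_combination a f (fun i => y i - y' i).
Proof.
rewrite /tensor_combination -sumrB; apply: eq_bigr => i _.
by rewrite linearBr scalerBr.
Qed.

Lemma convex_sum_le (I : finType) (a b : I -> R) (M : R) :
  (forall i, 0 <= a i) -> \sum_i a i = 1 -> (forall i, b i <= M) ->
  \sum_i a i * b i <= M.
Proof.
move=> a0 a1 bM; rewrite -[leRHS]mul1r -a1 mulr_suml.
by apply: ler_sum => i _; rewrite ler_wpM2l.
Qed.

Lemma tensor_combination_ball (I : finType) (a : I -> R) (f : I -> E)
    (y : I -> Y) :
  (forall i, 0 <= a i) -> \sum_i a i = 1 -> (forall i, rnorm (f i) <= 1) ->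
  (forall i, rnorm (y i) <= 1) -> unit_ball (tensor_combination a f y).
Proof.
move=> a0 a1 f1 y1; rewrite unit_ballE (le_trans (rnorm_sum _ _ _))//.
under eq_bigr do rewrite rnormZ rnorm_nneg//.
apply: convex_sum_le => // i.
by rewrite (le_trans (rnorm_tensor_le Z_tensor _ _))// mulr_ile1 ?rnorm_ge0.
Qed.

Lemma weak_seminorm_tensor_combination ls (I : finType) (a : I -> R)
    (f : I -> E) (y : I -> Y) : (forall i, 0 <= a i) ->
  weak_seminorm ls (tensor_combination a f y) <=
    \sum_i a i * weak_seminorm ls (t (f i) (y i)).
Proof.
move=> a0; apply: le_trans (weak_seminorm_sum _ _ _) _.
by apply: ler_sum => i _; rewrite weak_seminormZ rnorm_nneg.
Qed.

(** Since [l] has norm at most one and takes the value [1] at the convex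
    combination of the [y i], the [y i] with nonzero coefficients all lie in the
    face of the unit ball where [l] is [1]. *)
Definition face_representation (z : Z) (I : finType) (a : I -> R) (f : I -> E)
    (y : I -> Y) (l : topdual Y) :=
  [/\ forall i, 0 <= a i, \sum_i a i = 1, forall i, rnorm (f i) <= 1 &
      forall i, rnorm (y i) <= 1] /\
  [/\ forall v, rnorm (l v : R[i]^o) <= rnorm v,
      l (\sum_i (a i)%:C *: y i) = 1 & z = tensor_combination a f y].

Lemma right_functional (l : topdual Z) (e : E) :
  exists l' : topdual Y, forall y, l' y = l (t e y).
Proof.
have [M M0 lM] := topdual_bounded l.
pose F : {linear Y -> R[i]^o} := (l \o t e).
have cF : continuous F.
  apply: (@rnorm_bounded_continuous _ _ _ F (M * rnorm e)) => y.
  apply: le_trans (lM _) _; rewrite -mulrA ler_wpM2l//.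
  exact: rnorm_tensor_le.
by exists (TopDual cF).
Qed.

(** The combination is moved in its second factors only. The [y i] are replaced
    by vectors that are close to them for the functionals obtained from the
    neighbourhood by fixing the first factor [f i], and whose combination has
    norm one. *)
Lemma face_representation_sphere (W : set Z) :
  weakly_open_combinations_meet_sphere Y ->
  relatively_weakly_open W -> W !=set0 ->
  exists z (I : finType) (a : I -> R) (f : I -> E) (y : I -> Y) l,
    W z /\ face_representation z a f y l.
Proof.
move=> sphere [U oU ->] [u0 [+ Uu0]]; rewrite unit_ballE => u01.
have [r r0 rU] := weak_open_norm oU Uu0.
have [n [a [f [y [a0 a1 f1 y1 /rU Uu]]]]] := unit_ball_approx Z_tensor u01 r0.
have [ls [e e0 eU]] := weak_open_seminorm oU Uu.
have /choice[ll' llP] : forall i : 'I_n, exists L : topdual Z -> topdual Y,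
    forall l v, L l v = l (t (f i) v).
  by move=> i; have /choice[L LP] := right_functional^~ (f i); exists L.
pose V i : set Y := @unit_ball R Y `&` [set v : Y |
  weak_seminorm (map (ll' i) ls) (v - y i) < e / 2].
have e2 : 0 < e / 2 by lra.
have VP i : relatively_weakly_open (V i) /\ V i !=set0.
  split; first by exists [set v | weak_seminorm (map (ll' i) ls) (v - y i) < e / 2]
     => //; exact: weak_ball_open.
  by exists (y i); split; rewrite ?unit_ballE//= subrr weak_seminorm0.
have [|| v [[y' y'V vE] v1]] := sphere n (fun i => (a i)%:C) V _ _ VP.
- by move=> i; rewrite ler0c.
- by rewrite -rmorph_sum a1.
have [l [l1 lv]] := norming_functional v.
exists (tensor_combination a f y'), 'I_n, a, f, y', l.
have y'1 i : rnorm (y' i) <= 1.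
  by have [+ _] := y'V i; rewrite unit_ballE.
split; last first.
  split=> //; split=> //; rewrite -vE lv.
  by move: v1; rewrite unit_sphereE => ->.
split; first exact: tensor_combination_ball.
apply: eU; rewrite -/(tensor_combination a f y) tensor_combinationBr.
apply: le_lt_trans (weak_seminorm_tensor_combination _ _ _ a0) _.
apply: (@le_lt_trans _ _ (e / 2)); last lra.
apply: convex_sum_le => // i; have [_ /ltW] := y'V i.
apply: le_trans; rewrite /weak_seminorm big_map.
by apply: ler_sum => k _; rewrite llP.
Qed.

(** The second factors are approximated by absolutely convex combinations of
    points of the face. These are expanded, with their scalars moved to the first
    factors, so that only points of the face are left on the right. *)
Lemma face_representation_aconv (W : set Z) :
  ball_aconv_of_face Y -> relatively_weakly_open W -> W !=set0 ->
  exists z (I : finType) (a : I -> R) (f : I -> E) (y : I -> Y) l,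
    W z /\ face_representation z a f y l.
Proof.
move=> [l /[dup] l_norm /dual_norm1_le l1 face].
set S := [set y | _] in face.
move=> [U oU ->] [u0 [+ Uu0]]; rewrite unit_ballE => u01.
have [r r0 rU] := weak_open_norm oU Uu0.
have r2 : 0 < r / 2 by lra.
have [n [a [f [y [a0 a1 f1 y1 uu0]]]]] := unit_ball_approx Z_tensor u01 r2.
have near_aconv (v : Y) (e : R) : rnorm v <= 1 -> 0 < e ->
    exists2 v', aconv S v' & rnorm (v' - v) < e.
  rewrite -unit_ballE -face => Sv e0.
  have [|v' [Sv' v'v]] := Sv [set v' | rnorm (v' - v) < e]; last by exists v'.
  by apply/nbhs_rnormP; exists e => // u; rewrite rnormBC.
(* an empty face would have closed hull {0}, and [l] would vanish *)
have S0 : S !=set0.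
  apply/set0P/eqP => S0.
  have v0 (v : Y) : rnorm v <= 1 -> v = 0.
    move=> v1; apply: rnorm0_eq0; apply/eqP; rewrite eq_le rnorm_ge0 andbT.
    apply/ler_addgt0Pr => e e0; rewrite add0r.
    have [v' [m [k [b [_ Sb ->]]]]] := near_aconv v e v1 e0.
    rewrite big1 ?sub0r ?rnormN => [/ltW//|i _].
    by have := Sb i; rewrite S0.
  move: l_norm; rewrite /dual_norm (_ : [set _ | _ in _] = [set 0]).
    by rewrite sup1 => /esym/eqP; rewrite oner_eq0.
  apply/seteqP; split=> [_ [v + <-]|_ ->].
    by rewrite unit_ballE => /v0->; rewrite linear0 rnorm0.
  by exists 0; rewrite ?linear0 ?rnorm0// unit_ballE rnorm0.
have /choice[y' y'P] : forall i, exists v, aconv S v /\ rnorm (v - y i) < r / 2.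
  by move=> i; have [v] := near_aconv (y i) (r / 2) (y1 i) r2; exists v.
(* [p i] packs the length, coefficients, scalars and points for [y' i] *)
have /choice[p pP] : forall i, exists p : {m : nat &
      (('I_m -> R) * ('I_m -> R[i]) * ('I_m -> Y))%type},
    [/\ forall j, 0 <= (tagged p).1.1 j, \sum_j (tagged p).1.1 j = 1,
      forall j, rnorm ((tagged p).1.2 j : R[i]^o) <= 1,
      forall j, S ((tagged p).2 j) &
      y' i = \sum_j ((tagged p).1.1 j)%:C *:
        ((tagged p).1.2 j *: (tagged p).2 j)].
  move=> i; have [Sy' _] := y'P i.
  have [m [b [c [v bcv]]]] := aconvP S0 Sy'.
  by exists (existT _ m (b, c, v)).
pose b i := (tagged (p i)).1.1; pose c i := (tagged (p i)).1.2.
pose v i := (tagged (p i)).2.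
have b0 i j : 0 <= b i j by have [+ _ _ _ _] := pP i; exact.
have b1 i : \sum_j b i j = 1 by have [] := pP i.
have c1 i j : rnorm (c i j : R[i]^o) <= 1 by have [_ _ + _ _] := pP i; exact.
have Sv i j : S (v i j) by have [_ _ _ + _] := pP i; exact.
have y'E i : y' i = \sum_j (b i j)%:C *: (c i j *: v i j) by have [] := pP i.
pose I : finType := {i : 'I_n & 'I_(tag (p i))}.
pose a' (k : I) := a (tag k) * b (tag k) (tagged k).
pose f' (k : I) := c (tag k) (tagged k) *: f (tag k).
pose v' (k : I) := v (tag k) (tagged k).
have a'1 : \sum_k a' k = 1.
  rewrite -(sig_big_dep xpredT (fun=> xpredT) (fun i j => a i * b i j))/= -a1.
  by apply: eq_bigr => i _; rewrite -mulr_sumr b1 mulr1.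
have zE : tensor_combination a f y' = tensor_combination a' f' v'.
  rewrite /tensor_combination.
  rewrite -(sig_big_dep xpredT (fun=> xpredT) (fun i j =>
    (a i * b i j)%:C *: t (c i j *: f i) (v i j)))/=.
  apply: eq_bigr => i _; rewrite y'E linear_sumr scaler_sumr.
  apply: eq_bigr => j _; rewrite scale_realM !linearZr_LR/=.
  by rewrite (linearZl_LR t (v i j)).
exists (tensor_combination a' f' v'), I, a', f', v', l.
have a'0 k : 0 <= a' k by rewrite mulr_ge0.
have f'1 k : rnorm (f' k) <= 1 by rewrite rnormZ mulr_ile1 ?rnorm_ge0.
have v'1 k : rnorm (v' k) <= 1.
  by have [+ _] := Sv (tag k) (tagged k); rewrite unit_ballE.
split; last first.
  split=> //; split=> //; rewrite linear_sum -[RHS]/(1%:C) -a'1 rmorph_sum.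
  apply: eq_bigr => k _; have [_ lv] := Sv (tag k) (tagged k).
  by rewrite linearZ/= lv; exact: mulr1.
split; first exact: tensor_combination_ball.
apply: rU; rewrite -zE.
rewrite -(subrK (tensor_combination a f y) (tensor_combination a f y')).
rewrite -addrA; apply: le_lt_trans (rnormD _ _) _.
suff : rnorm (tensor_combination a f y' - tensor_combination a f y) <= r / 2.
  by rewrite /tensor_combination in uu0 *; lra.
rewrite tensor_combinationBr; apply: le_trans (rnorm_sum _ _ _) _.
under eq_bigr do rewrite rnormZ rnorm_nneg//.
apply: convex_sum_le => // i; apply: le_trans (rnorm_tensor_le Z_tensor _ _) _.
have [_ /ltW y'y] := y'P i; apply: le_trans y'y.
by rewrite ler_piMl ?rnorm_ge0.
Qed.

End FaceRepresentation.

(** * The weak diameter two property *)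

Section LimitPoints.
Variable T : topologicalType.

(** If there were finitely many points, removing them from [U] would leave a
    neighbourhood of [w] without other points of [S]. *)
Lemma limit_point_infinite (S U : set T) w : hausdorff_space T ->
  limit_point S w -> open U -> U w -> infinite_set (S `&` U).
Proof.
move=> hT lw oU Uw fin.
have fin' : finite_set ((S `&` U) `\ w) by exact: sub_finite_set fin.
have cl : closed ((S `&` U) `\ w).
  by move/hausdorff_accessible/accessible_finite_set_closed : hT; apply.
have [|y [/eqP yw Sy [Uy ny]]] := lw (U `&` ~` ((S `&` U) `\ w)).
  apply: open_nbhs_nbhs; split; first by apply: openI => //; exact: closed_openC.
  by split=> // -[_]; apply.
by apply: ny.
Qed.

End LimitPoints.

Section ElementaryForm.
Variables (R : realType) (E F : normedModType R[i]).
Variables (g : {linear E -> R[i]^o}) (l : {linear F -> R[i]^o}).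

Definition elementary_form (e : E) (f : F) : R[i]^o := g e * l f.

Lemma elementary_form_bilinear :
  bilinear_for (GRing.Scale.Law.clone _ _ *:%R _)
    (GRing.Scale.Law.clone _ _ *:%R _) elementary_form.
Proof.
split=> [f a u v|e a u v]; rewrite /elementary_form linearP.
  by rewrite mulrDl [in RHS]/GRing.scale/= mulrA.
by rewrite mulrDr [in RHS]/GRing.scale/= mulrCA.
Qed.

HB.instance Definition _ := bilinear_isBilinear.Build R[i] E F R[i]^o _ _
  elementary_form elementary_form_bilinear.

End ElementaryForm.

Section Summing.
Variables (R : realType) (T : topologicalType) (X Y : normedModType R[i]).
Variables (AX : closed_subspace (Cb T X)).
Local Notation E := (banach_subspace AX).
Variables (Z : completeNormedModType R[i]) (t : {bilinear E -> Y -> Z}).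
Hypothesis Z_tensor : is_projective_tensor_product t.

Lemma summing_weak_seminorm ls (y : Y) :
  summing (fun g : E => weak_seminorm ls (t g y)).
Proof.
apply: summing_sum => l; have [M M0 lM] := topdual_bounded l.
pose L : {linear E -> R[i]^o} := l \o applyr t y.
apply: (@summing_functional _ _ _ _ L (M * rnorm y)).
  by rewrite mulr_ge0 ?rnorm_ge0.
move=> g; apply: le_trans (lM _) _; rewrite -mulrA ler_wpM2l// mulrC.
exact: rnorm_tensor_le.
Qed.

(** The left-hand side is the modulus of the value of the bilinear form
    [(f, y) |-> k (f w) * l y], whose norm is at most one. *)
Lemma tensor_combination_lower_bound (I : finType) (a : I -> R) (f : I -> E)
    (y : I -> Y) w (k : topdual X) (l : topdual Y) :
  (forall v, rnorm (k v : R[i]^o) <= rnorm v) ->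
  (forall v, rnorm (l v : R[i]^o) <= rnorm v) ->
  rnorm (\sum_i (a i)%:C * (k (eval_at w (f i)) * l (y i)) : R[i]^o) <=
  rnorm (tensor_combination t a f y).
Proof.
move=> k1 l1; pose s := [seq ((a i)%:C *: f i, y i) | i : I].
pose K : {linear E -> R[i]^o} := k \o eval_at w.
have -> : tensor_combination t a f y = tensor_eval t s.
  rewrite /tensor_eval big_map big_enum; apply: eq_bigr => i _.
  by rewrite /= (linearZl_LR t (y i)).
rewrite (rnorm_tensor_eval Z_tensor).
have -> : \sum_i (a i)%:C * (k (eval_at w (f i)) * l (y i)) =
    tensor_eval (elementary_form K l) s.
  rewrite /tensor_eval big_map big_enum; apply: eq_bigr => i _ /=.
  by rewrite /elementary_form linearZ /= mulrA.
apply: bilinear_le_projective_norm => g v.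
rewrite /elementary_form rnormM ler_pM ?rnorm_ge0//.
by rewrite (le_trans (k1 _))// rnorm_eval_at.
Qed.

End Summing.

Theorem theorem3p10 (R : realType) (X : completeNormedModType R[i])
  (Omega : topologicalType) (Omega_regular : regular_space Omega)
  (Omega_hausdorff : hausdorff_space Omega)
  (A : set (Cb Omega R[i]^o)) (A_alg : function_algebra A)
  (AX : closed_subspace (Cb Omega X)) (AX_alg : vector_function_algebra AX)
  (AX_base : base_algebra AX = A)
  (SB_infinite :
    infinite_set (limit_point (strong_boundary A) `&` strong_boundary A))
  (Y : completeNormedModType R[i])
  (Y_ab : weakly_open_combinations_meet_sphere Y \/ ball_aconv_of_face Y)
  (Z : completeNormedModType R[i])
  (t : {bilinear banach_subspace AX -> Y -> Z})
  (Z_tensor : is_projective_tensor_product t) :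
  weak_DD2P Z.
Proof.
(* [X] is not trivial, since peak functions come from functions into [X] *)
have [x [k [x1 k1 kx]]] : exists (x : X) (k : topdual X),
    [/\ rnorm x = 1, forall v, rnorm (k v : R[i]^o) <= rnorm v & k x = 1].
  have [w [_ wA]] := infinite_setN0 SB_infinite.
  have [p [Ap pw _ _]] := strong_boundary_peak A_alg wA openT I ltr01.
  move: Ap; rewrite -AX_base => -[h _ [x' hE]].
  have hw0 : rnorm (h w) != 0.
    apply/eqP => /rnorm0_eq0 hw0; move: (hE w); rewrite pw hw0 linear0.
    by move/eqP; rewrite oner_eq0.
  have x1 : rnorm ((rnorm (h w))^-1%:C *: h w) = 1.
    by rewrite rnormZ rnorm_nneg ?invr_ge0 ?rnorm_ge0// mulVf.
  have [k [k1 kx]] := norming_functional ((rnorm (h w))^-1%:C *: h w).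
  by exists ((rnorm (h w))^-1%:C *: h w), k; rewrite kx x1.
move=> W oW W0.
have [u [I [a [f [y [l [Wu [[a0 a1 f1 y1] [l1 ly uE]]]]]]]]] :
    exists z (I : finType) (a : I -> R) (f : I -> banach_subspace AX)
      (y : I -> Y) l, W z /\ face_representation t z a f y l.
  case: Y_ab => HY.
    exact: face_representation_sphere.
  exact: face_representation_aconv.
have [U oU WE] := oW.
have Uu : U u by move: Wu; rewrite WE => -[].
have small_move (ls : seq (topdual Z)) (g g' : I -> banach_subspace AX) e :
    \sum_i weak_seminorm ls (t (g' i - g i) (y i)) < e ->
    weak_seminorm ls (tensor_combination t a g' y - tensor_combination t a g y) < e.
  apply: le_lt_trans; rewrite tensor_combinationBl.
  apply: le_trans (weak_seminorm_tensor_combination _ _ _ _ a0) _.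
  apply: ler_sum => i _; rewrite ler_piMl//.
    by apply: sumr_ge0 => j _; exact: rnorm_ge0.
  by rewrite -a1 (bigD1 i)//= lerDl sumr_ge0.
have [ls [e e0 eU]] := weak_open_seminorm oU Uu.
have x1_le : rnorm x <= 1 by rewrite x1.
have [w [f' [[lw wA] f'1 f'w f'f]]] := prescribe_value_nearby A_alg AX_alg
  AX_base Omega_hausdorff SB_infinite (@subIsetr _ _ _) f1
  (fun i => summing_weak_seminorm Z_tensor ls (y i)) x1_le e0.
pose z := tensor_combination t a f' y.
exists z.
  rewrite WE; split; first exact: tensor_combination_ball.
  by apply: eU; rewrite uE; exact: small_move.
move=> W' [U' oU' ->] [z1 U'z].
have [ls' [e' e'0 eU']] := weak_open_seminorm oU' U'z.
have z1' : rnorm z <= 1 by rewrite -unit_ballE.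
have far d : 0 < d ->
    exists2 v, (@unit_ball R Z `&` (U' : set Z)) v & 2 - d <= rnorm (z - v).
  move=> d0; pose near_x := [set s | \sum_i rnorm (eval_at s (f' i) - x) < d].
  have near_x_open : open near_x.
    apply: (open_sum_rnorm_lt _ (f := fun i s => eval_at s (f' i) - x)) => i s.
    by apply: cvgB; [exact: Cb_continuous|exact: cvg_cst].
  have near_xw : near_x w.
    by rewrite /near_x /= big1// => i _; rewrite f'w subrr rnorm0.
  have Nx1 : rnorm (- x) <= 1 by rewrite rnormN.
  have [s [f'' [[sA s_near] f''1 f''s f''f']]] := prescribe_value_nearby A_alg
    AX_alg AX_base Omega_hausdorff
    (limit_point_infinite Omega_hausdorff lw near_x_open near_xw)
    (@subIsetl _ _ _) f'1 (fun i => summing_weak_seminorm Z_tensor ls' (y i))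
    Nx1 e'0.
  (* the [f' i] are close to [x] at [s], where the [f'' i] are [- x] *)
  exists (tensor_combination t a f'' y).
    split; first exact: tensor_combination_ball.
    by apply: eU'; exact: small_move.
  rewrite tensor_combinationBl.
  apply: le_trans (tensor_combination_lower_bound Z_tensor _ _ _ s k1 l1).
  pose err := \sum_i (a i)%:C * (k (eval_at s (f' i) - x) * l (y i)).
  have -> : \sum_i (a i)%:C * (k (eval_at s (f' i - f'' i)) * l (y i)) = 2 - (- err).
    have <- : \sum_i (a i)%:C * (2 * l (y i)) = 2.
      under eq_bigr do rewrite mulrCA.
      rewrite -mulr_sumr -[RHS]mulr1 -ly linear_sum; congr (_ * _).
      by apply: eq_bigr => i _; rewrite linearZ.
    rewrite opprK /err -big_split; apply: eq_bigr => i _ /=.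
    rewrite eval_atB f''s opprK -mulrDr -mulrDl; congr (_ * (_ * _)).
    by rewrite linearD linearB /= kx addrC -addrA; congr (_ + _); ring.
  have err_lt : rnorm (err : R[i]^o) <= d.
    apply: ltW; apply: le_lt_trans s_near; apply: le_trans (rnorm_sum _ _ _) _.
    apply: ler_sum => i _; rewrite !rnormM rnorm_nneg//.
    have ai1 : a i <= 1 by rewrite -a1 (bigD1 i)//= lerDl sumr_ge0.
    have kl : rnorm (k (eval_at s (f' i) - x) : R[i]^o) * rnorm (l (y i) : R[i]^o)
        <= rnorm (eval_at s (f' i) - x).
      rewrite -[leRHS]mulr1 ler_pM ?rnorm_ge0//.
      by rewrite (le_trans (l1 _)).
    by apply: le_trans kl; rewrite ler_piMl// mulr_ge0 ?rnorm_ge0.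
  have two : rnorm (2 : R[i]^o) = 2.
    by rewrite -(rmorph_nat (real_complex R)) rnorm_nneg.
  have := rnormD (V := R[i]^o) (2 - (- err)) (- err); rewrite subrK two rnormN.
  lra.
apply/eqP; rewrite eq_le; apply/andP; split.
  apply: ge_sup => [|_ [v [+ _] <-]]; first by exists (rnorm (z - z)), z.
  by rewrite unit_ballE => v1; apply: le_trans (rnormB _ _) _; lra.
apply/ler_addgt0Pr => d d0; have [v W'v dv] := far d d0.
suff : rnorm (z - v) <=
  sup [set rnorm (z - v') | v' in @unit_ball R Z `&` (U' : set Z)] by lra.
apply: ub_le_sup; last by exists v.
exists 2 => _ [v' [+ _] <-]; rewrite unit_ballE => v1.
by apply: le_trans (rnormB _ _) _; lra.
Qed.
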